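(* Define integers $j(n)$ ($n\ge -1$) by the formal expansion $$\sum_{n\ge -1}j(n)q^n =\frac{\left(1+240\sum_{n\ge 1}\frac{n^3q^n}{1-q^n}\right)^3}{q\prod_{i\ge 1} (1-q^i)^{24}},$$ and integers $c(n)$ ($n\ge 0$) by $$\sum_{n\ge 0}c(n)q^n = \frac{1}{\prod_{i\ge 1} (1-q^i)(1-q^{2i})}.$$ Let $f_j^1(x)$ be the number of integers $n$ with $-1\le n\le x$ such that $j(n)$ is odd, and $f_c^1(x)$ the number of integers $n$ with $0\le n\le x$ such that $c(n)$ is odd. Then there exist constants $C>0$ and $x_0$ such that for all $x\ge x_0$, $$f_j^1(x)\ \ge\ C\,\frac{\sqrt{x} \log \log x}{\log x}\quad\text{and}\quad f_c^1(x)\ \ge\ C\,\frac{\sqrt{x} \log \log x}{\log x}.$$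
   Context: $j(n)$ are the Fourier coefficients of the Klein $j$-function and $c(n)$ is the cubic partition function (the number of partitions of $n$ into parts of two kinds, where parts of the second kind must be even). The notation $A(x)\gg B(x)$ in the paper means $A(x)\ge C\,B(x)$ for some constant $C>0$ and all sufficiently large $x$. *)

(* Defs.v *)
From HB Require Import structures.
From mathcomp Require Import all_boot all_order all_algebra finmap.
From mathcomp Require Import all_classical all_reals all_analysis.
Set Implicit Arguments.
Unset Strict Implicit.
Unset Printing Implicit Defensive.
Import Order.TTheory GRing.Theory Num.Theory.
Local Open Scope classical_set_scope.
Local Open Scope ring_scope.

(* A formal power series over the integers is its coefficient sequence. The
   library's ring structure on [nat -> int] is the pointwise one, so the product
   and the unit of power series are given separate names here. *)
Definition fps := nat -> int.

Definition fps1 : fps := fun n => (n == 0%N)%:R.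

Definition fps_Xn (i : nat) : fps := fun n => (n == i)%:R.

Definition fps_add (f g : fps) : fps := fun n => f n + g n.

Definition fps_sub (f g : fps) : fps := fun n => f n - g n.

Definition fps_scale (a : int) (f : fps) : fps := fun n => a * f n.

Definition fps_mul (f g : fps) : fps :=
  fun n => \sum_(k < n.+1) f k * g (n - k)%N.

Definition fps_exp (f : fps) (m : nat) : fps := iter m (fps_mul f) fps1.

(* The geometric series of 1 - f: the inverse of f when f has constant term 1
   (see [fps_mulV]). *)
Definition fps_inv (f : fps) : fps :=
  fun n => \sum_(k < n.+1) fps_exp (fps_sub fps1 f) k n.

(* The infinite sum of the F i and the infinite product of the F i, i >= 1. The
   coefficient of q^n is read off the n-th partial sum or product; this is the
   formal limit when F i is 0, respectively 1, modulo q^i (see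
   [fps_sum_stable] and [fps_prod_stable]). *)
Definition fps_sum (F : nat -> fps) : fps :=
  fun n => \sum_(1 <= i < n.+1) F i n.

Definition fps_prod (F : nat -> fps) : fps :=
  fun n => (\big[fps_mul/fps1]_(1 <= i < n.+1) F i) n.

Definition one_sub_qpow (i : nat) : fps := fps_sub fps1 (fps_Xn i).

Definition eisenstein4 : fps :=
  fps_add fps1
    (fps_scale 240
      (fps_sum (fun n =>
         fps_scale (n%:R ^+ 3)
           (fps_mul (fps_Xn n) (fps_inv (one_sub_qpow n)))))).

(* q times the Laurent series of the j-function *)
Definition qj_series : fps :=
  fps_mul (fps_exp eisenstein4 3)
    (fps_inv (fps_prod (fun i => fps_exp (one_sub_qpow i) 24))).

Definition j_coef (n : int) : int :=
  match n + 1 with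
  | Posz m => qj_series m
  | Negz _ => 0
  end.

Definition c_coef : nat -> int :=
  fps_inv (fps_prod (fun i =>
    fps_mul (one_sub_qpow i) (one_sub_qpow (2 * i)%N))).

Definition oddz (a : int) : bool := ~~ (2 %| a)%Z.

Definition j_odd_set (R : realType) (x : R) : set int :=
  [set n : int | [/\ -1 <= n, n%:~R <= x & oddz (j_coef n)]].

Definition c_odd_set (R : realType) (x : R) : set nat :=
  [set n : nat | n%:R <= x /\ oddz (c_coef n)].

(* [fset_set] is the given set when that set is finite, which is so here (see
   [finite_j_odd_set] and [finite_c_odd_set]). *)
Definition f_j1 (R : realType) (x : R) : nat := #|` fset_set (j_odd_set x)|.

Definition f_c1 (R : realType) (x : R) : nat := #|` fset_set (c_odd_set x)|.

Lemma fps_mul1l (f : fps) n : fps_mul fps1 f n = f n.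
Proof.
rewrite /fps_mul big_ord_recl /= subn0 /fps1 eqxx mul1r big1 ?addr0 // => i _.
by rewrite mul0r.
Qed.

Lemma fps_exp_small (h : fps) k n : h 0%N = 0 -> (n < k)%N -> fps_exp h k n = 0.
Proof.
move=> h0; elim: k n => [//|k IHk] n ltnk.
rewrite /fps_exp iterS -/(fps_exp h k) /fps_mul big1 // => -[[|i] lti] _ /=.
  by rewrite h0 mul0r.
rewrite IHk ?mulr0 //.
by rewrite ltn_subLR // addSn ltnS (leq_trans _ (leq_addl _ _)).
Qed.

Lemma fps_mulV (f : fps) : f 0%N = 1 -> fps_mul f (fps_inv f) =1 fps1.
Proof.
move=> f0 n; pose h := fps_sub fps1 f.
have h0 : h 0%N = 0 by rewrite /h /fps_sub f0 subrr.
have invE m : (m <= n)%N -> fps_inv f m = \sum_(k < n.+1) fps_exp h k m.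
  move=> lemn; rewrite /fps_inv -/h -!(big_mkord xpredT (fun k => fps_exp h k m)).
  rewrite [RHS](@big_cat_nat _ _ _ m.+1) //=.
  rewrite [X in _ + X]big_nat_cond [X in _ + X]big1 ?addr0 //.
  by move=> i /andP[/andP[? _] _]; rewrite fps_exp_small.
have step k : fps_mul f (fps_exp h k) n = fps_exp h k n - fps_exp h k.+1 n.
  rewrite -[in RHS](fps_mul1l (fps_exp h k)) /fps_exp iterS -/(fps_exp h k).
  rewrite /fps_mul -sumrB; apply: eq_bigr => i _.
  by rewrite -mulrBl /h /fps_sub opprB addrC subrK.
transitivity (\sum_(k < n.+1) fps_mul f (fps_exp h k) n).
  rewrite /fps_mul exchange_big /=; apply: eq_bigr => i _.
  by rewrite invE ?leq_subr // mulr_sumr.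
under eq_bigr do rewrite step.
rewrite -(big_mkord xpredT (fun k => fps_exp h k n - fps_exp h k.+1 n)).
rewrite (@telescope_sumr_eq _ _ _ (fun k => - fps_exp h k n)) //; last first.
  by move=> k _; rewrite opprK addrC.
by rewrite fps_exp_small // oppr0 opprK add0r.
Qed.

Lemma fps_sum_stable (F : nat -> fps) n N :
  (forall i k, (k < i)%N -> F i k = 0) -> (n <= N)%N ->
  \sum_(1 <= i < N.+1) F i n = fps_sum F n.
Proof.
move=> F0 lenN; rewrite /fps_sum (@big_cat_nat _ _ _ n.+1) //=.
rewrite [X in _ + X]big_nat_cond [X in _ + X]big1 ?addr0 //.
by move=> i /andP[/andP[? _] _]; rewrite F0.
Qed.

Lemma fps_mul_congr (f f' g g' : fps) n :
  (forall k, (k <= n)%N -> f k = f' k) -> (forall k, (k <= n)%N -> g k = g' k) ->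
  fps_mul f g n = fps_mul f' g' n.
Proof.
move=> ff gg; apply: eq_bigr => i _.
by rewrite ff ?gg ?leq_subr // -ltnS.
Qed.

Lemma fps_prod_tail (F : nat -> fps) m n r :
  (forall i k, (k < i)%N -> F i k = fps1 k) -> all (fun i => n < i)%N r ->
  (m <= n)%N -> (\big[fps_mul/fps1]_(i <- r) F i) m = fps1 m.
Proof.
move=> F1; elim: r m => [|i r IHr] m; first by rewrite big_nil.
move=> /= /andP[ni ar] mn; rewrite big_cons -[RHS]fps_mul1l.
apply: fps_mul_congr => k km; first by apply: F1; rewrite (leq_ltn_trans _ ni) ?(leq_trans km).
by apply: IHr => //; apply: leq_trans mn.
Qed.

Lemma fps_prod_stable (F : nat -> fps) n N :
  (forall i k, (k < i)%N -> F i k = fps1 k) -> (n <= N)%N ->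
  (\big[fps_mul/fps1]_(1 <= i < N.+1) F i) n = fps_prod F n.
Proof.
move=> F1 lenN; rewrite /fps_prod /index_iota !subn1 /=.
rewrite -(subnKC lenN) iotaD.
have: all (fun i => n < i)%N (iota (1 + n) (N - n)).
  by apply/allP => i; rewrite mem_iota add1n => /andP[].
move: (iota (1 + n) _) => t at_.
suff H s m : (m <= n)%N -> (\big[fps_mul/fps1]_(i <- s ++ t) F i) m =
    (\big[fps_mul/fps1]_(i <- s) F i) m by exact: H.
elim: s m => [|i s IHs] m mn.
  by rewrite /= big_nil (fps_prod_tail (n := n)).
rewrite /= !big_cons; apply: fps_mul_congr => // k km.
by apply: IHs; apply: leq_trans mn.
Qed.

Lemma finite_c_odd_set (R : realType) (x : R) : finite_set (c_odd_set x).
Proof.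
apply: (@sub_finite_set _ _ `I_(Num.truncn x).+1); last exact: finite_II.
move=> n [nx _] /=; rewrite ltnS.
by rewrite truncn_ge_nat // (le_trans _ nx).
Qed.

Lemma finite_j_odd_set (R : realType) (x : R) : finite_set (j_odd_set x).
Proof.
apply: (@sub_finite_set _ _ ((fun k : nat => k%:Z - 1) @` `I_(Num.truncn (x + 1)).+1)).
  move=> n [n1 nx _] /=; exists `|(n + 1)%R|%N; last first.
    by rewrite gez0_abs ?addrK // -lerBlDr sub0r.
  have n0 : 0 <= n + 1 by rewrite -lerBlDr sub0r.
  have E : (`|(n + 1)%R|%N)%:R = n%:~R + 1 :> R.
    by rewrite -[LHS]/((`|(n + 1)%R|%N%:Z)%:~R) gez0_abs // intrD.
  have Ex : (`|(n + 1)%R|%N)%:R <= x + 1 by rewrite E lerD2r.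
  by rewrite ltnS truncn_ge_nat // (le_trans _ Ex).
by apply: finite_image; exact: finite_II.
Qed.

(* Main.v *)
Require Import Defs.
From HB Require Import structures.
From mathcomp Require Import all_boot all_order all_algebra finmap.
From mathcomp Require Import all_classical all_reals all_analysis.
From mathcomp Require Import zify ring lra.
Set Implicit Arguments.
Unset Strict Implicit.
Unset Printing Implicit Defensive.
Import Order.TTheory GRing.Theory Num.Theory.
Local Open Scope ring_scope.

(** Let psi = sum_k q^(k(k+1)/2). Modulo 2 one has prod_i (1 - q^i)^3 = psi, so
    the series of c(n) is 1/psi, and that of j(n) is obtained from it by
    q -> q^8 and a shift. Multiplying by psi^8 = psi(q^8), which has only
    O(sqrt x) terms up to x, gives psi^7 = psi(q) psi(q^2) psi(q^4); hence the
    number of odd c(n), n <= x, is at least the number of odd coefficients of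
    psi^7 up to x divided by O(sqrt x).

    The n-th coefficient of psi^7 is the number of representations
    8n+7 = a^2 + 2b^2 + 4c^2 by positive odd a, b, c. Zagier's involution and
    Liouville's elementary method show that it is congruent modulo 2 to
    sigma(8n+7)/8, at least when 8n+7 = pq with primes p = 3 and q = 5 mod 8; in
    that case it is (p+1)(q+1)/8 up to parity, which is odd.

    Finally there are >> x log log x / log x such products pq up to x, by
    Mertens' theorem for the progressions 3 and 5 mod 8, which is elementary
    because the three real characters mod 8 visibly have L(1, chi) > 0. *)

(** * Power series modulo 2 *)

(** Why products pq are used: a prime N = 7 mod 8 makes sigma(N)/8 odd only when N = 7 mod 16. For p
    = 3 and q = 5 mod 8, however, p + 1 is 4 times an odd number and q + 1 is twice an odd number,
    so (p+1)(q+1)/8 is always odd. The abundance of such products is also what supplies the factor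
    log log x.

    The division by 8 is realised as three halvings of a signed count of solutions of ax + by = N:
    the factor 2 in Liouville's identity for a cosine, and two symmetries without fixed points.
    Modulo 2 the signs then disappear, and the remaining set is linked to the representations
    counted by psi^7 through involutions whose fixed points can be compared.

    On the analytic side every Mertens sum is known only up to a bounded error. Primes are therefore
    located in wide intervals (n, Ln], with L a constant so large that ln L exceeds the errors at
    both ends. This yields lower bounds of the right order of magnitude for counts and for
    reciprocal sums. *)

Lemma big_sqr_char2 (R : comNzRingType) (I : Type) (r : seq I) (F : I -> R) :
  2%:R = 0 :> R -> (\sum_(i <- r) F i) ^+ 2 = \sum_(i <- r) F i ^+ 2.
Proof.
move=> R2; apply: (big_morph (fun x : R => x ^+ 2)); last by rewrite expr0n.
by move=> x y; rewrite sqrrD -mulr_natr R2 mulr0 addr0.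
Qed.

Definition tri (k : nat) : nat := 'C(k.+1, 2).

Lemma triS k : tri k.+1 = (tri k + k.+1)%N.
Proof. by rewrite /tri binS bin1. Qed.

Lemma double_tri k : (2 * tri k)%N = (k * k.+1)%N.
Proof. elim: k => [//|k IH]; rewrite triS mulnDr IH; lia. Qed.

Lemma leq_tri k : (k <= tri k)%N.
Proof. by case: k => [//|k]; rewrite triS leq_addl. Qed.

(* D. Shanks, "A short proof of an identity of Euler": the difference of two
   consecutive instances telescopes along g. *)
Lemma shanks (R : comNzRingType) (q : R) n :
  \sum_(s < n.+1) (\prod_(s <= k < n) (1 - q ^+ k.+1.*2))
     * (\prod_(k < s) (1 - q ^+ k.*2.+1)) * q ^+ (s * n.*2.+1)
  = (\prod_(k < n) (1 - q ^+ k.*2.+1)) * \sum_(s < n.*2.+1) q ^+ tri s.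
Proof.
elim: n => [|n IH].
  by rewrite !big_ord_recr !big_ord0 /= big_geq // !mul1r !add0r.
pose A s := \prod_(s <= k < n) (1 - q ^+ k.+1.*2).
pose O s := \prod_(k < s) (1 - q ^+ k.*2.+1).
pose g s := if s is s'.+1 then A s' * O s * q ^+ (s * n.*2.+1) else 0.
have OS s : O s.+1 = O s * (1 - q ^+ s.*2.+1) by rewrite /O big_ord_recr.
have gE s : (s <= n)%N -> g s = (1 - q ^+ s.*2) * (A s * O s * q ^+ (s * n.*2.+1)).
  case: s => [|s] sn; first by rewrite expr0 subrr mul0r.
  by rewrite /g /A (big_ltn sn) !mulrA.
have step s : (s <= n)%N ->
    (\prod_(s <= k < n.+1) (1 - q ^+ k.+1.*2)) * O s * q ^+ (s * n.+1.*2.+1)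
    = (1 - q ^+ n.*2.+1) * (A s * O s * q ^+ (s * n.*2.+1)) + (g s.+1 - g s).
  move=> sn; rewrite (gE _ sn) /g OS big_nat_recr //= -/(A s).
  have -> : (s * n.+1.*2.+1 = s * n.*2.+1 + s.*2)%N by lia.
  have -> : (s.+1 * n.*2.+1 = s * n.*2.+1 + n.*2.+1)%N by lia.
  have -> : (n.+1.*2 = n.*2.+1 + 1)%N by lia.
  have -> : (s.*2.+1 = s.*2 + 1)%N by lia.
  rewrite !exprD expr1; ring.
rewrite big_ord_recr /= -/(O n.+1) big_geq // mul1r.
under eq_bigr => s _ do rewrite step ?leq_ord //.
rewrite big_split /= -mulr_sumr -(big_mkord xpredT (fun s => g s.+1 - g s)).
rewrite telescope_sumr // IH -/(O n) mulrCA mulrA -OS /g subr0.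
rewrite /A big_geq // mul1r.
have -> : (n.+1.*2.+1 = n.*2.+3)%N by lia.
rewrite (big_ord_recr n.*2.+2) (big_ord_recr n.*2.+1) /=.
have -> : (n.+1 * n.*2.+1)%N = tri n.*2.+1 by have := double_tri n.*2.+1; lia.
have -> : (n.+1 * n.*2.+3)%N = tri n.*2.+2 by have := double_tri n.*2.+2; lia.
ring.
Qed.

(** Stands in for equality of power series over F_2: every series is truncated to a polynomial, and
    divisibility by X^M lets the polynomial library do the algebra. *)
Definition eqX (M : nat) (p q : {poly 'F_2}) : bool := 'X^M %| p - q.

Lemma eqXP M (p q : {poly 'F_2}) : reflect (forall i, (i < M)%N -> p`_i = q`_i) (eqX M p q).
Proof.
apply: (iffP idP) => [/dvdpP[r E] i iM | H].
  by apply/eqP; rewrite -subr_eq0 -coefB E coefMXn iM.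
rewrite /eqX -(poly_take_drop M (p - q)) (_ : take_poly M _ = 0) ?add0r ?dvdp_mull //.
by apply/polyP => i; rewrite coef_take_poly coef0; case: ifP => // iM; rewrite coefB H ?subrr.
Qed.

Lemma eqXx M p : eqX M p p. Proof. exact/eqXP. Qed.

Lemma eqX_sym M p q : eqX M p q -> eqX M q p.
Proof. by move/eqXP => H; apply/eqXP => i iM; rewrite H. Qed.

Lemma eqX_trans M q p r : eqX M p q -> eqX M q r -> eqX M p r.
Proof. by move=> /eqXP H /eqXP K; apply/eqXP => i iM; rewrite H ?K. Qed.

Lemma eqXM M p p' q q' : eqX M p p' -> eqX M q q' -> eqX M (p * q) (p' * q').
Proof.
rewrite /eqX => Hp Hq; rewrite (_ : p * q - _ = (p - p') * q + p' * (q - q')); last by ring.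
by apply: dvdp_add; [exact: dvdp_mulr | exact: dvdp_mull].
Qed.

Lemma eqX_exp M p p' k : eqX M p p' -> eqX M (p ^+ k) (p' ^+ k).
Proof. by move=> Hp; elim: k => [|k IH]; rewrite ?eqXx // !exprS eqXM. Qed.

Definition euler (n : nat) : {poly 'F_2} := \prod_(k < n) (1 - 'X^(k.+1)).

Definition psi (n : nat) : {poly 'F_2} := \sum_(s < n) 'X^(tri s).

Lemma poly2_char2 : 2%:R = 0 :> {poly 'F_2}.
Proof. by rewrite -polyC_natr (_ : 2%:R = 0) // ; apply/eqP. Qed.

Lemma sqr_one_sub (p : {poly 'F_2}) : (1 - p) ^+ 2 = 1 - p ^+ 2.
Proof.
have E := poly2_char2.
rewrite (_ : (1 - p) ^+ 2 = 1 - p ^+ 2 + 2%:R * (p ^+ 2 - p)); last by ring.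
by rewrite E mul0r addr0.
Qed.

Lemma euler_sqr n : euler n ^+ 2 = \prod_(k < n) (1 - 'X^(k.+1.*2)).
Proof.
rewrite /euler -prodrXl; apply: eq_bigr => k _.
by rewrite sqr_one_sub -exprM muln2.
Qed.

Lemma euler_double n :
  euler n.*2 = (\prod_(k < n) (1 - 'X^(k.*2.+1))) * \prod_(k < n) (1 - 'X^(k.+1.*2)).
Proof.
rewrite /euler; elim: n => [|n IH]; first by rewrite !big_ord0 mulr1.
rewrite doubleS !big_ord_recr /= IH doubleS; ring.
Qed.

Lemma psi_stable M n : (M <= n)%N -> eqX M (psi n) (psi M).
Proof.
move=> Mn; apply/eqXP => i iM; rewrite !coef_sum -!(big_mkord xpredT (fun s => 'X^(tri s)`_i)).
rewrite (@big_cat_nat _ _ _ M 0 n) //= [X in _ + X]big_nat_cond [X in _ + X]big1 ?addr0 //.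
move=> s /andP[/andP[Ms _] _]; rewrite coefXn.
by case: eqP => // E; have := leq_tri s; lia.
Qed.

Lemma euler_stable M n : (M <= n)%N -> eqX M (euler n) (euler M).
Proof.
elim: n => [|n IH]; first by rewrite leqn0 => /eqP ->; rewrite eqXx.
rewrite leq_eqVlt => /orP[/eqP -> | Mn]; first exact: eqXx.
rewrite /euler big_ord_recr /= -/(euler n) -/(euler M) -[X in eqX _ _ X]mulr1.
apply: eqXM; first exact: IH.
rewrite /eqX (_ : _ - _ = - 'X^(n.+1)); last by ring.
by rewrite dvdpNr dvdp_exp2l // ltnW.
Qed.

Lemma euler_coprime M n : coprimep 'X^M (euler n).
Proof.
rewrite coprimep_expl // coprimep_sym /euler.
elim/big_ind: _ => [|p q Hp Hq|k _]; first by rewrite coprime1p.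
  by rewrite coprimepMl Hp.
by rewrite coprimepX /root !hornerE /= expr0n /= ?subr0 ?oner_eq0.
Qed.

(** In the identity [shanks] the terms with s > 0 vanish modulo X^M and the term s = 0 is the
    product over even exponents, which over F_2 is [euler M ^+ 2]. So Euler's square is the odd
    product times psi. Multiplying by the even product, again Euler's square, completes the odd
    product to Euler's product. One factor [euler M], invertible modulo X^M, is then cancelled. *)
Lemma euler_cube M : eqX M (euler M ^+ 3) (psi M).
Proof.
suff H : eqX M (euler M * euler M ^+ 3) (euler M * psi M).
  by move: H; rewrite /eqX -mulrBr Gauss_dvdpr // euler_coprime.
have E1 : eqX M (euler M ^+ 2)
    ((\prod_(k < M) (1 - 'X^(k.*2.+1))) * \sum_(s < M.*2.+1) 'X^(tri s)).
  rewrite -shanks big_ord_recl /= big_ord0 mulr1 mul0n expr0 mulr1 big_mkord.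
  rewrite -euler_sqr /eqX opprD addrA subrr sub0r dvdpNr.
  apply: (big_ind (fun p => 'X^M %| p)) => [|p q Hp Hq|s _]; rewrite ?dvdp0 ?dvdp_add //.
  by rewrite dvdp_mull // dvdp_exp2l //= /bump; nia.
have -> : euler M * euler M ^+ 3 = euler M ^+ 2 * euler M ^+ 2 by ring.
apply: eqX_trans (eqXM E1 (eqXx _ _)) _.
rewrite [X in _ * X]euler_sqr mulrAC -euler_double.
apply: eqXM; first by apply: euler_stable; lia.
by apply: (@psi_stable _ M.*2.+1); lia.
Qed.

(** * Reduction of the integer series modulo 2 *)

Definition tpoly (M : nat) (f : fps) : {poly 'F_2} := \poly_(i < M) (f i)%:~R.

Lemma tpoly_eq M f g : (forall i, (i < M)%N -> f i = g i) -> tpoly M f = tpoly M g.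
Proof. by move=> E; apply/polyP => i; rewrite !coef_poly; case: ifP => // /E ->. Qed.

Lemma tpoly_mul M f g : eqX M (tpoly M (fps_mul f g)) (tpoly M f * tpoly M g).
Proof.
apply/eqXP => i iM; rewrite coef_poly iM coefM /fps_mul rmorph_sum /=.
apply: eq_bigr => k _; have ki := ltn_ord k.
by rewrite !coef_poly !ifT ?rmorphM //; lia.
Qed.

Lemma tpoly1 M : eqX M (tpoly M fps1) 1.
Proof. by apply/eqXP => i iM; rewrite coef_poly iM coef1 /fps1; case: (i == 0)%N. Qed.

Lemma tpoly_exp M f k : eqX M (tpoly M (fps_exp f k)) (tpoly M f ^+ k).
Proof.
elim: k => [|k IH]; first exact: tpoly1.
rewrite exprS /fps_exp iterS; apply: eqX_trans (tpoly_mul _ _ _) _.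
by apply: eqXM; [exact: eqXx | exact: IH].
Qed.

Lemma tpoly_one_sub M i : eqX M (tpoly M (one_sub_qpow i)) (1 - 'X^i).
Proof.
apply/eqXP => k kM; rewrite coef_poly kM coefB coef1 coefXn.
by rewrite /one_sub_qpow /fps_sub /fps1 /fps_Xn rmorphB /=; do 2 case: eqP.
Qed.

Lemma tpoly_prod M (F : nat -> fps) (G : nat -> {poly 'F_2}) :
  (forall i k, (k < i)%N -> F i k = fps1 k) ->
  (forall i, eqX M (tpoly M (F i)) (G i)) ->
  eqX M (tpoly M (fps_prod F)) (\prod_(k < M) G k.+1).
Proof.
move=> F1 FG; rewrite (@tpoly_eq M _ (\big[fps_mul/fps1]_(1 <= i < M.+1) F i)); last first.
  by move=> i iM; rewrite -(fps_prod_stable F1 (ltnW iM)).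
rewrite -(big_mkord xpredT (fun k => G k.+1)) big_add1 /=.
elim: (index_iota _ _) => [|i r IH]; first by rewrite !big_nil tpoly1.
rewrite !big_cons; apply: eqX_trans (tpoly_mul _ _ _) _.
exact: eqXM.
Qed.

Lemma tpoly_inv M f p : f 0%N = 1 -> eqX M (tpoly M f) p -> eqX M (p * tpoly M (fps_inv f)) 1.
Proof.
move=> f0 fp; apply: eqX_trans (tpoly1 M).
rewrite -(@tpoly_eq M _ _ (fun i _ => fps_mulV f0 i)).
apply: eqX_sym; apply: eqX_trans (tpoly_mul _ _ _) _.
by apply: eqXM => //; exact: eqXx.
Qed.

Lemma one_sub_qpow_small i k : (k < i)%N -> one_sub_qpow i k = fps1 k.
Proof. by move=> ki; rewrite /one_sub_qpow /fps_sub /fps_Xn ltn_eqF // subr0. Qed.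

Lemma fps_mul_small (f g : fps) i k :
  (forall k, (k < i)%N -> f k = fps1 k) -> (forall k, (k < i)%N -> g k = fps1 k) ->
  (k < i)%N -> fps_mul f g k = fps1 k.
Proof.
move=> Hf Hg ki; rewrite -[RHS]fps_mul1l; apply: fps_mul_congr => l lk.
  by apply: Hf; apply: leq_ltn_trans ki.
by apply: Hg; apply: leq_ltn_trans ki.
Qed.

Lemma fps_exp_congr1 (f : fps) i m k :
  (forall k, (k < i)%N -> f k = fps1 k) -> (k < i)%N -> fps_exp f m k = fps1 k.
Proof.
move=> Hf; elim: m k => [//|m IH] k ki.
by rewrite /fps_exp iterS; apply: fps_mul_small ki.
Qed.

Lemma fps_prod0 (F : nat -> fps) : fps_prod F 0%N = 1.
Proof. by rewrite /fps_prod big_geq. Qed.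

(** By Frobenius 1 - X^(2i) is the square of 1 - X^i, so the denominator of the series of c is the
    cube of Euler's product. *)
Lemma psi_mul_c M : eqX M (psi M * tpoly M c_coef) 1.
Proof.
apply: tpoly_inv; first exact: fps_prod0.
apply: eqX_trans (euler_cube M).
rewrite /euler -prodrXl.
apply: (@tpoly_prod M _ (fun i => (1 - 'X^i) ^+ 3)) => [i k ki | i].
  by apply: (@fps_mul_small _ _ i) => // l li; apply: one_sub_qpow_small; lia.
apply: eqX_trans (tpoly_mul _ _ _) _; rewrite exprS; apply: eqXM.
  exact: tpoly_one_sub.
by rewrite sqr_one_sub -exprM mulnC; exact: tpoly_one_sub.
Qed.

Lemma tpoly_eisenstein4 M : eqX M (tpoly M eisenstein4) 1.
Proof.
apply: eqX_trans (tpoly1 M); apply/eqXP => i iM; rewrite !coef_poly iM.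
rewrite /eisenstein4 /fps_add /fps_scale rmorphD rmorphM /=.
by rewrite (_ : 240%:~R = 0) ?mul0r ?addr0 //; apply/eqP.
Qed.

(** The Eisenstein series is 1 modulo 2 because 240 is even, and the 24th power of Euler's product
    is the eighth power of its cube. *)
Lemma psi_mul_qj M : eqX M (psi M ^+ 8 * tpoly M qj_series) 1.
Proof.
rewrite -[1]mul1r; apply: eqX_trans (eqXM (eqXx _ _) (tpoly_mul _ _ _)) _.
rewrite mulrCA; apply: eqXM.
  apply: eqX_trans (tpoly_exp _ _ _) _.
  by rewrite -[1](expr1n _ 3); apply: eqX_exp; exact: tpoly_eisenstein4.
apply: tpoly_inv; first exact: fps_prod0.
apply: eqX_trans (eqX_exp 8 (euler_cube M)).
rewrite -exprM /euler -prodrXl.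
apply: (@tpoly_prod M _ (fun i => (1 - 'X^i) ^+ 24)) => [i k ki | i].
  by apply: (@fps_exp_congr1 _ i) => // l li; apply: one_sub_qpow_small; lia.
apply: eqX_trans (tpoly_exp _ _ _) _.
by apply: eqX_exp; exact: tpoly_one_sub.
Qed.

(** Both sides are inverses of psi^8 modulo X^M. *)
Lemma qj_eq_c8 M : eqX M (tpoly M qj_series) (tpoly M c_coef ^+ 8).
Proof.
have H1 := eqX_exp 8 (psi_mul_c M); have H2 := psi_mul_qj M.
set J := tpoly M qj_series in H2 *; set c := tpoly M c_coef in H1 *.
apply: (@eqX_trans _ (J * (psi M * c) ^+ 8)).
  by rewrite -{1}[J]mulr1 -(expr1n _ 8); apply: eqXM; [exact: eqXx | exact: eqX_sym].
rewrite exprMn (_ : J * _ = (psi M ^+ 8 * J) * c ^+ 8); last by ring.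
by rewrite -[X in eqX _ _ X]mul1r; apply: eqXM; [exact: H2 | exact: eqXx].
Qed.

Lemma oddzE (a : int) : oddz a = (a%:~R != 0 :> 'F_2).
Proof.
rewrite /oddz; congr (~~ _).
have [b [-> | ->]] : exists b : int, a = b * 2 \/ a = b * 2 + 1.
  by exists (a %/ 2)%Z; have := divz_eq a 2; have := ltz_pmod a (isT : 0 < 2 :> int);
     have := modz_ge0 a (isT : 2 != 0 :> int); lia.
  by rewrite dvdz_mull // rmorphM /= (_ : 2%:~R = 0) ?mulr0 ?eqxx //; apply/eqP.
rewrite rmorphD rmorphM /= (_ : 2%:~R = 0) ?mulr0 ?add0r; last by apply/eqP.
by rewrite rpredDl ?dvdz_mull.
Qed.

Lemma coef_exp8 (p : {poly 'F_2}) m : (p ^+ 8)`_(8 * m) = p`_m.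
Proof.
have H (r : {poly 'F_2}) l : (r ^+ 2)`_(2 * l) = r`_l.
  rewrite -{1}[r]coefK poly_def big_sqr_char2 ?poly2_char2 // coef_sum.
  under eq_bigr => i _ do rewrite exprZn -exprM coefZ coefXn.
  have [lr | rl] := ltnP l (size r); last first.
    rewrite nth_default // big1 // => i _.
    by case: eqP => [E|_]; rewrite ?mulr0 //; have := ltn_ord i; lia.
  rewrite (bigD1 (Ordinal lr)) //= big1 ?addr0; last first.
    move=> i /eqP il; case: eqP => [E|_]; rewrite ?mulr0 //.
    by case: il; apply: val_inj => /=; lia.
  rewrite (_ : (_ == _)%N = true) ?mulr1; last by apply/eqP; lia.
  by case: (r`_l) => [[|[|]]] //= ?; apply: val_inj.
by rewrite -[8%N]/(2 * (2 * 2))%N -!mulnA !exprM !H.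
Qed.

Lemma oddz_qj m : oddz (qj_series (8 * m)) = oddz (c_coef m).
Proof.
rewrite !oddzE; congr (_ != _); set M := (8 * m).+1.
have /eqXP/(_ (8 * m)%N (ltnSn _)) := qj_eq_c8 M.
rewrite coef_poly ltnSn coef_exp8 coef_poly ifT //.
by rewrite /M; lia.
Qed.

Lemma psi_sqr n : psi n ^+ 2 = \sum_(s < n) 'X^(2 * tri s).
Proof.
rewrite big_sqr_char2 ?poly2_char2 //; apply: eq_bigr => i _.
by rewrite -exprM mulnC.
Qed.

(** By [leq_tri], bounding the three indices by n loses no representation. *)
Definition ntri (n : nat) : nat :=
  \sum_(i < n.+1) \sum_(j < n.+1) \sum_(k < n.+1) (tri i + 2 * tri j + 4 * tri k == n).

Lemma psi_pow4 n : psi n ^+ 4 = \sum_(s < n) 'X^(4 * tri s).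
Proof.
rewrite (exprM _ 2 2) psi_sqr big_sqr_char2 ?poly2_char2 //; apply: eq_bigr => i _.
by rewrite -exprM; congr 'X^_; lia.
Qed.

Lemma psi_pow8 n : psi n ^+ 8 = \sum_(s < n) 'X^(8 * tri s).
Proof.
rewrite (exprM _ 4 2) psi_pow4 big_sqr_char2 ?poly2_char2 //; apply: eq_bigr => i _.
by rewrite -exprM; congr 'X^_; lia.
Qed.

Lemma coef_psi7 n : (psi n.+1 ^+ 7)`_n = (ntri n)%:R.
Proof.
rewrite (_ : psi n.+1 ^+ 7 = psi n.+1 * psi n.+1 ^+ 2 * psi n.+1 ^+ 4); last by ring.
rewrite psi_sqr psi_pow4 /psi /ntri !mulr_suml coef_sum natr_sum; apply: eq_bigr => i _.
rewrite [X in X * _]mulr_sumr mulr_suml coef_sum natr_sum; apply: eq_bigr => j _.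
rewrite mulr_sumr coef_sum natr_sum; apply: eq_bigr => k _.
by rewrite -!exprD coefXn eq_sym; case: eqP.
Qed.

(** Compare the coefficients of q^n in psi^8 / psi = psi^7. Since psi^8 is a sum of monomials q^(8
    tri k), an odd coefficient on the right forces an odd c(n - 8 tri k) for some k. *)
Lemma ntri_odd n : odd (ntri n) ->
  exists2 k, (8 * tri k <= n)%N & oddz (c_coef (n - 8 * tri k)).
Proof.
move=> nodd; set M := n.+1.
have /eqXP/(_ n (ltnSn n)) E : eqX M (psi M ^+ 8 * tpoly M c_coef) (psi M ^+ 7).
  rewrite (_ : _ * _ = psi M ^+ 7 * (psi M * tpoly M c_coef)); last by ring.
  by rewrite -[X in eqX _ _ X]mulr1; apply: eqXM; [exact: eqXx | exact: psi_mul_c].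
have : (psi M ^+ 8 * tpoly M c_coef)`_n != 0.
  by rewrite E coef_psi7 -[ntri n]odd_double_half nodd -muln2 natrD natrM
    (_ : 2%:R = 0) ?mulr0 //; apply/eqP.
rewrite psi_pow8 mulr_suml coef_sum => /eqP H.
have [[k ck]|K] := pselect (exists k : 'I_M, ('X^(8 * tri k) * tpoly M c_coef)`_n != 0).
  move: ck; rewrite coefXnM; case: ltnP => [|kn]; first by rewrite eqxx.
  by rewrite coef_poly ltnS leq_subr -oddzE => ?; exists k.
case: H; apply: big1 => k _; apply/eqP/negPn/negP => ck; apply: K; by exists k.
Qed.

(** * Liouville's method *)

Lemma big_seq_bij (V : nmodType) (T U : eqType) (s : seq T) (t : seq U)
    (h : T -> U) (g : U -> T) (F : T -> V) (G : U -> V) :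
  uniq s -> uniq t ->
  (forall x, x \in s -> [/\ h x \in t, g (h x) = x & F x = G (h x)]) ->
  (forall y, y \in t -> g y \in s /\ h (g y) = y) ->
  \sum_(x <- s) F x = \sum_(y <- t) G y.
Proof.
move=> us ut hs gt; rewrite (perm_big (map h s)) ?big_map /=.
  by apply: eq_big_seq => x xs; case: (hs x xs).
apply: uniq_perm => //.
  rewrite map_inj_in_uniq // => x y xs ys E.
  by case: (hs x xs) => _ <- _; case: (hs y ys) => _ <- _; rewrite E.
move=> y; apply/idP/mapP => [yt | [x xs ->]]; last by case: (hs x xs).
by case: (gt y yt) => gs E; exists (g y).
Qed.

Lemma uniq_pairs (T U : eqType) (s : seq T) (t : seq U) : uniq s -> uniq t ->
  uniq [seq (x, y) | x <- s, y <- t].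
Proof. by move=> us ut; apply: allpairs_uniq => // -[x y] [x' y'] _ _ /= [-> ->]. Qed.

Lemma mem_pairs (T U : eqType) (s : seq T) (t : seq U) u v :
  ((u, v) \in [seq (x, y) | x <- s, y <- t]) = (u \in s) && (v \in t).
Proof.
apply/allpairsP/andP => [[[u' v'] /= [us vt [-> ->]]] // | [us vt]].
by exists (u, v).
Qed.

Definition quad : Type := (nat * nat * nat * nat)%type.

(* Locked, since simplification would otherwise unfold the enumeration. *)
Definition box (n : nat) : seq quad :=
  locked (let s := iota 0 n.+1 in
  [seq (v, y) | v <- [seq (u, x) | u <- [seq (a, b) | a <- s, b <- s], x <- s], y <- s]).

Lemma box_uniq n : uniq (box n).
Proof.
by rewrite /box -lock; do 3![apply: uniq_pairs; last exact: iota_uniq]; exact: iota_uniq.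
Qed.

Lemma mem_box n a b x y :
  ((a, b, x, y) \in box n) = [&& a <= n, b <= n, x <= n & y <= n]%N.
Proof.
have S k : (k \in iota 0 n.+1) = (k <= n)%N by rewrite mem_iota.
by rewrite /box -lock !mem_pairs !S -!andbA.
Qed.

(** As P and Q force membership in the box, both sums run over all quadruples satisfying them, and
    the bijection can be checked without reference to the box. *)
Lemma big_box_bij (V : nmodType) n (P Q : pred quad) (h g : quad -> quad)
    (F G : quad -> V) :
  (forall q, P q -> q \in box n) -> (forall q, Q q -> q \in box n) ->
  (forall q, P q -> [/\ Q (h q), g (h q) = q & F q = G (h q)]) ->
  (forall q, Q q -> P (g q) /\ h (g q) = q) ->
  \sum_(q <- box n | P q) F q = \sum_(q <- box n | Q q) G q.
Proof.
move=> Pb Qb hP gQ; rewrite -big_filter -[RHS]big_filter; apply: (big_seq_bij (h := h) (g := g)).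
- exact: filter_uniq (box_uniq n).
- exact: filter_uniq (box_uniq n).
- move=> q; rewrite mem_filter => /andP[Pq _]; case: (hP q Pq) => Qh -> ->.
  by rewrite mem_filter Qh Qb.
- move=> q; rewrite mem_filter => /andP[Qq _]; case: (gQ q Qq) => Pg ->.
  by rewrite mem_filter Pg Pb.
Qed.

Lemma box_count_parity n (P : pred quad) (h : quad -> quad) :
  (forall q, P q -> q \in box n) ->
  (forall q, P q -> P (h q) /\ h (h q) = q) ->
  odd (count P (box n)) = odd (count (fun q => P q && (h q == q)) (box n)).
Proof.
move=> Pb hP; rewrite -!sum1_count (bigID (fun q => h q == q)) /= oddD.
rewrite [X in _ (+) X](_ : _ = false) ?addbF //.
(* An injective coding by natural numbers selects one element of each two-element orbit of h; the
   selected and the unselected elements are equinumerous. *)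
rewrite (bigID (fun q => choice.pickle q < choice.pickle (h q))%N) /= oddD.
rewrite (@big_box_bij _ n (fun q => P q && (h q != q) && (choice.pickle q < choice.pickle (h q))%N)
  (fun q => P q && (h q != q) && ~~ (choice.pickle q < choice.pickle (h q))%N) h h
  (fun=> 1%N) (fun=> 1%N)) ?addbb //.
- by move=> q /andP[/andP[/Pb]].
- by move=> q /andP[/andP[/Pb]].
- move=> q /andP[/andP[Pq nq] lt]; have [Ph hh] := hP q Pq; split=> //.
  by rewrite Ph hh eq_sym nq -leqNgt ltnW.
- move=> q /andP[/andP[Pq nq] lt]; have [Ph hh] := hP q Pq; split=> //.
  rewrite Ph hh eq_sym nq /= ltn_neqAle leqNgt lt andbT.
  by apply: contraNneq nq => E; rewrite (pcan_inj (@choice.pickleK _) E).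
Qed.

Lemma big_trichotomy (V : nmodType) n (P : pred quad) (u v : quad -> nat) (F : quad -> V) :
  \sum_(q <- box n | P q) F q =
  \sum_(q <- box n | P q && (u q < v q)%N) F q +
  \sum_(q <- box n | P q && (u q == v q)) F q +
  \sum_(q <- box n | P q && (v q < u q)%N) F q.
Proof.
rewrite (bigID (fun q => u q < v q)%N) /= -addrA; congr (_ + _).
rewrite (bigID (fun q => u q == v q)) /=; congr (_ + _); apply: eq_bigl => q;
  by case: (P q) => //=; case: ltngtP.
Qed.

Definition sol (n : nat) : pred quad := fun q =>
  let '(a, b, x, y) := q in [&& 0 < a, 0 < b, 0 < x, 0 < y & a * x + b * y == n]%N.

Definition qa (q : quad) : nat := q.1.1.1.
Definition qb (q : quad) : nat := q.1.1.2.
Definition qx (q : quad) : nat := q.1.2.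
Definition qy (q : quad) : nat := q.2.

Lemma sol_box n q : sol n q -> q \in box n.
Proof.
case: q => [[[a b] x] y] /and5P[a0 b0 x0 y0 /eqP E]; rewrite mem_box.
have := leq_pmulr a x0; have := leq_pmulr b y0.
have := leq_pmull x a0; have := leq_pmull y b0; lia.
Qed.

Definition qswap (q : quad) : quad := let '(a, b, x, y) := q in (b, a, y, x).

(** A pair of equations, usable as one rewrite rule. Solutions have positive entries, so residues
    modulo y are taken in 1, ..., y, which explains the predecessors. *)
Lemma divn_mod_pred x y k : (0 < x <= y)%N ->
  ((x + y * k).-1 %/ y = k)%N * ((x + y * k).-1 %% y = x.-1)%N.
Proof.
move=> xy; have -> : ((x + y * k).-1 = k * y + x.-1)%N by lia.
have [y0 xy'] : (0 < y)%N /\ (x.-1 < y)%N by lia.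
by rewrite divnMDl // modnMDl divn_small // modn_small // addn0.
Qed.

(* Both sides count the classes of solutions with fixed (a, y) under the
   substitution (b, x) -> (b + a, x - y). *)
Lemma sum_sol_reduce n (f : nat -> int) :
  \sum_(q <- box n | sol n q && (qx q <= qy q)%N) f (qa q) =
  \sum_(q <- box n | sol n q && (qb q <= qa q)%N) f (qa q).
Proof.
apply: (@big_box_bij _ n _ _
  (fun q => let '(a, b, x, y) := q in (a, (b.-1 %% a).+1, x + y * (b.-1 %/ a), y)%N)
  (fun q => let '(a, b, x, y) := q in (a, b + a * (x.-1 %/ y), (x.-1 %% y).+1, y)%N)).
- by move=> q /andP[/sol_box].
- by move=> q /andP[/sol_box].
- case=> [[[a b] x] y] /andP[/and5P[/= a0 b0 x0 y0 /eqP E]]; rewrite /qx /qy /= => xy.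
  have Eb := divn_eq b.-1 a; have lb := ltn_pmod b.-1 a0.
  split=> //.
    rewrite /sol /qa /qb /= lb andbT a0 y0 /= addn_gt0 x0 /= -E.
    have : b = ((b.-1 %/ a) * a + (b.-1 %% a).+1)%N by lia.
    by move: (b.-1 %/ a)%N (b.-1 %% a)%N => u v Huv; apply/eqP; nia.
  by rewrite !(divn_mod_pred (b.-1 %/ a)) ?x0 //; move: (b.-1 %/ a)%N (b.-1 %% a)%N Eb lb => u v Eb lb; congr (_, _, _, _); lia.
- case=> [[[a b] x] y] /andP[/and5P[/= a0 b0 x0 y0 /eqP E]]; rewrite /qa /qb /= => ba.
  have Ex := divn_eq x.-1 y; have lx := ltn_pmod x.-1 y0.
  split.
    rewrite /sol /qx /qy /= lx andbT a0 y0 /= addn_gt0 b0 /= -E.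
    have : x = ((x.-1 %/ y) * y + (x.-1 %% y).+1)%N by lia.
    by move: (x.-1 %/ y)%N (x.-1 %% y)%N => u v Huv; apply/eqP; nia.
  by rewrite !(divn_mod_pred (x.-1 %/ y)) ?b0 //; move: (x.-1 %/ y)%N (x.-1 %% y)%N Ex lx => u v Ex lx; congr (_, _, _, _); lia.
Qed.

Lemma sum_sol_swap n (P Q : pred quad) (F G : quad -> int) :
  (forall q, Q q = P (qswap q)) -> (forall q, G q = F (qswap q)) ->
  \sum_(q <- box n | sol n q && P q) F q = \sum_(q <- box n | sol n q && Q q) G q.
Proof.
move=> PQ FG; have swapS q : sol n (qswap q) = sol n q.
  by case: q => [[[a b] x] y]; apply/and5P/and5P => -[-> -> -> -> /eqP <-];
    split=> //; rewrite addnC.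
have swapK q : qswap (qswap q) = q by case: q => [[[a b] x] y].
apply: (@big_box_bij _ n _ _ qswap qswap) => q /andP[sq Hq].
- exact: sol_box sq.
- exact: sol_box sq.
- by rewrite PQ FG swapK swapS sq Hq.
- by rewrite -PQ swapK swapS sq Hq.
Qed.

(* f is evaluated at |a - b|, written with truncated subtractions. *)
Lemma liouville n (f : nat -> int) :
  \sum_(q <- box n | sol n q) (f (qa q - qb q + (qb q - qa q))%N - f (qa q + qb q)%N) =
  \sum_(q <- box n | sol n q && (qa q == qb q)) (f 0%N + 2 * f (qa q)) -
  \sum_(q <- box n | sol n q && (qx q == qy q)) (f (qa q + qb q)%N + 2 * f (qa q)).
Proof.
rewrite sumrB !big_split /= -!mulr_sumr.
rewrite (big_trichotomy n (sol n) qa qb) (big_trichotomy n (sol n) qx qy).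
rewrite -(@sum_sol_swap n (fun q => qb q < qa q)%N _ (fun q => f (qa q - qb q + (qb q - qa q))%N));
  [|by move=> [[[a b] x] y]|by move=> [[[a b] x] y] /=; rewrite /qa /qb /= addnC].
rewrite -(@sum_sol_swap n (fun q => qx q < qy q)%N (fun q => qy q < qx q)%N (fun q => f (qa q + qb q)%N));
  [|by move=> [[[a b] x] y]|by move=> [[[a b] x] y] /=; rewrite /qa /qb /= addnC].
(* Since ax + by = (a - b)x + b(x + y), subtracting b from a and adding x to y maps the solutions
   with a > b onto those with x < y. E2 uses the inverse map. *)
have E1 : \sum_(q <- box n | sol n q && (qb q < qa q)%N) f (qa q - qb q + (qb q - qa q))%N =
    \sum_(q <- box n | sol n q && (qx q < qy q)%N) f (qa q).
  apply: (@big_box_bij _ n _ _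
    (fun q => let '(a, b, x, y) := q in (a - b, b, x, x + y)%N)
    (fun q => let '(a, b, x, y) := q in (a + b, b, x, y - x)%N)).
  - by move=> q /andP[/sol_box].
  - by move=> q /andP[/sol_box].
  - case=> [[[a b] x] y] /andP[/and5P[/= a0 b0 x0 y0 /eqP E]]; rewrite /qa /qb /qx /qy /= => ab.
    have [k Ek] : exists k, a = (b + k)%N by exists (a - b)%N; lia.
    subst a; rewrite addnC addKn; split; [|by congr (_, _, _, _); lia|by congr f; lia].
    by apply/andP; split; [apply/and5P; split; try lia; apply/eqP; nia | lia].
  - case=> [[[a b] x] y] /andP[/and5P[/= a0 b0 x0 y0 /eqP E]]; rewrite /qa /qb /qx /qy /= => xy.
    have [k Ek] : exists k, y = (x + k)%N by exists (y - x)%N; lia.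
    subst y; rewrite addKn; split; [|by congr (_, _, _, _); lia].
    by apply/andP; split; [apply/and5P; split; try lia; apply/eqP; nia | lia].
have E2 : \sum_(q <- box n | sol n q && (qx q < qy q)%N) f (qa q + qb q)%N =
    \sum_(q <- box n | sol n q && (qb q < qa q)%N) f (qa q).
  apply: (@big_box_bij _ n _ _
    (fun q => let '(a, b, x, y) := q in (a + b, b, x, y - x)%N)
    (fun q => let '(a, b, x, y) := q in (a - b, b, x, x + y)%N)).
  - by move=> q /andP[/sol_box].
  - by move=> q /andP[/sol_box].
  - case=> [[[a b] x] y] /andP[/and5P[/= a0 b0 x0 y0 /eqP E]]; rewrite /qa /qb /qx /qy /= => xy.
    have [k Ek] : exists k, y = (x + k)%N by exists (y - x)%N; lia.
    subst y; rewrite addKn; split; [|by congr (_, _, _, _); lia|by []].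
    by apply/andP; split; [apply/and5P; split; try lia; apply/eqP; nia | lia].
  - case=> [[[a b] x] y] /andP[/and5P[/= a0 b0 x0 y0 /eqP E]]; rewrite /qa /qb /qx /qy /= => ab.
    have [k Ek] : exists k, a = (b + k)%N by exists (a - b)%N; lia.
    subst a; rewrite addKn; split; [|by congr (_, _, _, _); lia].
    by apply/andP; split; [apply/and5P; split; try lia; apply/eqP; nia | lia].
(* After E1 and E2 the left side contains twice the difference of the sums of f(a) over x < y and
   over b < a. Splitting the ties off E3 expresses this difference by the diagonals a = b and x =
   y. *)
have E3 := sum_sol_reduce n f.
rewrite (bigID (fun q => qx q == qy q)) [RHS](bigID (fun q => qa q == qb q)) /= in E3.
have E4 (P Q U : pred quad) : (forall q, P q && Q q = U q) ->
    \sum_(q <- box n | sol n q && P q && Q q) f (qa q) =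
    \sum_(q <- box n | sol n q && U q) f (qa q).
  by move=> H; apply: eq_bigl => q; rewrite -andbA H.
rewrite (E4 _ _ (fun q => qx q == qy q)) in E3; last first.
  by move=> q; case: ltngtP.
rewrite (E4 _ _ (fun q => qx q < qy q)%N) in E3; last first.
  by move=> q; case: ltngtP.
rewrite (E4 _ _ (fun q => qa q == qb q)) in E3; last first.
  by move=> q; case: ltngtP.
rewrite (E4 _ _ (fun q => qb q < qa q)%N) in E3; last first.
  by move=> q; case: ltngtP.
rewrite (eq_bigr (fun q => f 0%N)
  (P := fun q => sol n q && (qa q == qb q)) (F1 := fun q => f (qa q - qb q + (qb q - qa q))%N)).
  have lin (A X B Y S U : int) : A + X = B + Y ->
    X + S + X - (Y + U + Y) = S + 2 * B - (U + 2 * A) by lia.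
  by rewrite E1 E2; exact: lin.
by move=> q /andP[_ /eqP ->]; rewrite subnn.
Qed.

Definition chi4 (m : nat) : int :=
  if (m %% 4 == 1)%N then 1 else if (m %% 4 == 3)%N then -1 else 0.

(** This is cos(pi m / 2), as [chi4] is sin(pi m / 2). It is the function put into Liouville's
    identity: the difference of cosines becomes a product of sines, hence of characters. *)
Definition cos4 (m : nat) : int :=
  if (m %% 4 == 0)%N then 1 else if (m %% 4 == 2)%N then -1 else 0.

Lemma cos4_sub a b : cos4 (a - b + (b - a)) - cos4 (a + b) = 2 * (chi4 a * chi4 b).
Proof.
rewrite /cos4 /chi4.
have : (a %% 4 < 4)%N by rewrite ltn_mod.
have : (b %% 4 < 4)%N by rewrite ltn_mod.
case Eb: (b %% 4)%N => [|[|[|[|//]]]] _; case Ea: (a %% 4)%N => [|[|[|[|//]]]] _ /=;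
  repeat case: eqP => ?; lia.
Qed.

Lemma chi4M a b : chi4 (a * b) = chi4 a * chi4 b.
Proof.
rewrite /chi4 -modnMm.
have : (a %% 4 < 4)%N by rewrite ltn_mod.
have : (b %% 4 < 4)%N by rewrite ltn_mod.
by case: (b %% 4)%N => [|[|[|[|//]]]] _; case: (a %% 4)%N => [|[|[|[|//]]]] _.
Qed.

Lemma chi4_odd a : odd a -> chi4 a = 1 \/ chi4 a = -1.
Proof.
move=> oa; rewrite /chi4.
have [->|->] : (a %% 4 = 1 \/ a %% 4 = 3)%N by lia.
  by left.
by right.
Qed.

Lemma chi4_even a : ~~ odd a -> chi4 a = 0.
Proof.
move=> oa; rewrite /chi4.
by have [->|->] : (a %% 4 = 0 \/ a %% 4 = 2)%N by lia.
Qed.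

Lemma sum_cos4 m : \sum_(1 <= x < m.*2.+1) (1 - 2 * cos4 x) = m.*2.+1%:Z - chi4 m.*2.+1.
Proof.
elim: m => [|m IH]; first by rewrite big_geq.
rewrite doubleS big_nat_recr //= big_nat_recr //= IH /cos4 /chi4.
by repeat case: eqP => ?; lia.
Qed.

(** Liouville's identity for [cos4]. For odd n, a = b forces a odd and x = y forces a + b odd, so
    [cos4] vanishes at these arguments. Exchanging (a, b) with (x, y) moves the second diagonal to
    the first, where a = b = d divides n and x runs from 1 to n/d - 1; [sum_cos4] evaluates the
    inner sum. *)
Lemma chi4_sum_divisors n : odd n ->
  2 * \sum_(q <- box n | sol n q) chi4 (qa q) * chi4 (qb q) =
  \sum_(d <- divisors n) ((n %/ d)%:Z - chi4 (n %/ d)).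
Proof.
move=> on; have n0 : (0 < n)%N by case: n on.
rewrite mulr_sumr; under eq_bigr => q _ do rewrite -cos4_sub.
rewrite liouville.
have -> : \sum_(q <- box n | sol n q && (qa q == qb q)) (cos4 0 + 2 * cos4 (qa q)) =
   \sum_(q <- box n | sol n q && (qa q == qb q)) 1.
  apply: eq_bigr => -[[[a b] x] y] /andP[/and5P[_ _ _ _ /eqP E]]; rewrite /qa /qb /= => /eqP ab.
  have oa : odd a by move: on; rewrite -E ab -mulnDr oddM => /andP[].
  by rewrite /cos4 mod0n /=; repeat case: eqP => ?; lia.
have -> : \sum_(q <- box n | sol n q && (qx q == qy q)) (cos4 (qa q + qb q) + 2 * cos4 (qa q)) =
   \sum_(q <- box n | sol n q && (qa q == qb q)) 2 * cos4 (qx q).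
  apply: (@big_box_bij _ n _ _ (fun q => let '(a, b, x, y) := q in (x, y, a, b))
    (fun q => let '(a, b, x, y) := q in (x, y, a, b))).
  - by move=> q /andP[/sol_box].
  - by move=> q /andP[/sol_box].
  - move=> [[[a b] x] y] /andP[/and5P[a0 b0 x0 y0 /eqP E]]; rewrite /qa /qb /qx /qy /= => /eqP xy.
    subst y; split=> //; first by rewrite eqxx a0 b0 x0 /= andbT; apply/eqP; lia.
    have oa : odd (a + b) by move: on; rewrite -E -mulnDl oddM => /andP[].
    by rewrite /cos4; repeat case: eqP => ?; lia.
  - move=> [[[a b] x] y] /andP[/and5P[a0 b0 x0 y0 /eqP E]]; rewrite /qa /qb /qx /qy /= => /eqP ab.
    by subst b; split=> //; rewrite eqxx a0 y0 x0 /= andbT; apply/eqP; lia.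
rewrite -sumrB -big_filter.
transitivity (\sum_(p <- [seq (d, x) | d <- divisors n, x <- index_iota 1 (n %/ d)])
    (1 - 2 * cos4 p.2)).
  apply: (big_seq_bij (h := fun q : quad => (qa q, qx q))
    (g := fun p => (p.1, p.1, p.2, n %/ p.1 - p.2)%N)).
  - exact: filter_uniq (box_uniq n).
  - apply: allpairs_uniq_dep => [|d _|[d x] [d' x'] _ _ /= [-> ->]] //; first exact: divisors_uniq.
    exact: iota_uniq.
  - move=> [[[a b] x] y]; rewrite mem_filter => /andP[/andP[/and5P[a0 b0 x0 y0 /eqP E]]].
    rewrite /qa /qb /qx /qy /= => /eqP ab _; subst b.
    have Ed : (n %/ a = x + y)%N by rewrite -E -mulnDr mulKn.
    split=> //; last by rewrite Ed addKn.
    apply/allpairsPdep; exists a, x; split=> //.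
      by rewrite -dvdn_divisors // -E -mulnDr dvdn_mulr.
    by rewrite mem_index_iota Ed; lia.
  - move=> [d x] /allpairsPdep[d' [x' [dn xd [-> ->]]]] /=.
    move: dn xd; rewrite -dvdn_divisors // mem_index_iota => /dvdnP[k Ek] xk.
    have d0 : (0 < d')%N by case: (d') Ek => //; lia.
    have Ed : (n %/ d' = k)%N by rewrite Ek mulnK.
    rewrite Ed in xk *; split=> //; rewrite mem_filter.
    have S : sol n (d', d', x', k - x')%N.
      apply/and5P; split; try lia; rewrite -mulnDr subnKC ?Ek 1?mulnC //; lia.
    apply/andP; split; last exact: sol_box S.
    by rewrite S /qa /qb /= eqxx.
rewrite big_allpairs_dep; apply: eq_big_seq => d; rewrite -dvdn_divisors // => /dvdnP[k Ek] /=.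
have : odd k by move: on; rewrite Ek oddM => /andP[].
have d0 : (0 < d)%N by case: (d) Ek => //; lia.
rewrite Ek mulnK // => ok; rewrite -[k]odd_double_half ok add1n.
exact: sum_cos4.
Qed.

Lemma divisors_pq p q : prime p -> prime q -> p != q ->
  perm_eq (divisors (p * q)) [:: 1; p; q; p * q]%N.
Proof.
move=> pp pq npq; have p1 := prime_gt1 pp; have q1 := prime_gt1 pq.
apply: uniq_perm; first exact: divisors_uniq.
  by rewrite /= !inE !negb_or npq; repeat (apply/andP; split) => //; apply/eqP; nia.
move=> d; rewrite -dvdn_divisors ?muln_gt0 ?prime_gt0 // !inE.
apply/idP/idP => [dpq|/or4P[] /eqP ->]; last first.
- exact: dvdnn.
- exact: dvdn_mull.
- exact: dvdn_mulr.
- exact: dvd1n.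
have [pd|npd] := boolP (p %| d)%N.
  case/dvdnP: pd dpq => k ->; rewrite mulnC dvdn_pmul2l ?prime_gt0 // => kq.
  by case/primeP: pq => _ /(_ k kq) /pred2P[] ->; rewrite ?muln1 eqxx ?orbT.
have dq : (d %| q)%N.
  by move: dpq; rewrite Gauss_dvdr // coprime_sym prime_coprime.
by case/primeP: pq => _ /(_ d dq) /pred2P[] ->; rewrite eqxx ?orbT.
Qed.

(** The character part of the divisor sum is (1 + chi4 p)(1 + chi4 q), which is zero as p = 3 mod 4;
    sigma(pq) remains. *)
Lemma chi4_sum_pq p q : prime p -> prime q -> (p %% 8 = 3)%N -> (q %% 8 = 5)%N ->
  2 * \sum_(t <- box (p * q) | sol (p * q) t) chi4 (qa t) * chi4 (qb t) =
  (p.+1 * q.+1)%N%:Z.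
Proof.
move=> pp pq p8 q8; have npq : p != q by apply/eqP => E; move: p8; rewrite E q8.
rewrite chi4_sum_divisors; last by rewrite oddM; apply/andP; split; lia.
rewrite (perm_big _ (divisors_pq pp pq npq)) !big_cons big_nil.
rewrite divn1 divnn muln_gt0 !prime_gt0 // mulKn ?prime_gt0 // mulnK ?prime_gt0 // chi4M.
have -> : chi4 p = -1 by rewrite /chi4 ifF ?ifT //; apply/eqP; lia.
have -> : chi4 q = 1 by rewrite /chi4 ifT //; apply/eqP; lia.
rewrite (_ : chi4 true = 1) //=; lia.
Qed.

(** * Parity of the number of representations *)

Definition qsol (N : nat) : pred quad := fun t =>
  sol N t && [&& odd (qa t), odd (qb t), odd (qx t) & ~~ odd (qy t)].

(** Only odd a and b contribute. Then exactly one of x and y is odd, and the exchange (a, x) <-> (b,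
    y) matches the two cases. *)
Lemma chi4_sum_odd N : odd N ->
  \sum_(t <- box N | sol N t) chi4 (qa t) * chi4 (qb t) =
  2 * \sum_(t <- box N | qsol N t) chi4 (qa t) * chi4 (qb t).
Proof.
move=> oN; rewrite (bigID (fun t => odd (qa t) && odd (qb t))) /= [X in _ + X]big1 ?addr0; last first.
  by move=> t /andP[_]; rewrite negb_and => /orP[] /chi4_even ->; rewrite ?mul0r ?mulr0.
have parity a b x y : sol N (a, b, x, y) -> (odd a && odd x) (+) (odd b && odd y).
  by case/and5P => _ _ _ _ /eqP E; rewrite -!oddM -oddD E.
rewrite (bigID (fun t => odd (qx t))) /= mulrDl !mul1r; congr (_ + _).
  apply: eq_bigl => t; rewrite /qsol -!andbA; case S: (sol N t) => //=.
  case: t S => [[[a b] x] y] /parity; rewrite /qa /qb /qx /qy /=.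
  by case: (odd a); case: (odd b); case: (odd x); case: (odd y).
symmetry; rewrite /qsol.
refine (eq_trans (@sum_sol_swap N
  (fun t => [&& odd (qa t), odd (qb t), odd (qx t) & ~~ odd (qy t)])
  (fun t => [&& odd (qb t), odd (qa t), odd (qy t) & ~~ odd (qx t)])
  (fun t => chi4 (qa t) * chi4 (qb t)) (fun t => chi4 (qa t) * chi4 (qb t)) _ _) _).
- by move=> [[[a b] x] y].
- by move=> [[[a b] x] y]; rewrite /qa /qb /= mulrC.
- apply: eq_bigl => t; rewrite -!andbA; case S: (sol N t) => //=.
  case: t S => [[[a b] x] y] /parity; rewrite /qa /qb /qx /qy /=.
  by case: (odd a); case: (odd b); case: (odd x); case: (odd y).
Qed.

Lemma sum_box_antisym n (P : pred quad) (h : quad -> quad) (F : quad -> int) :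
  (forall t, P t -> t \in box n) ->
  (forall t, P t -> [/\ P (h t), h (h t) = t & F (h t) = - F t]) ->
  \sum_(t <- box n | P t) F t = 0.
Proof.
move=> Pb hP.
suff: \sum_(t <- box n | P t) F t = - \sum_(t <- box n | P t) F t.
  by move: (\sum_(t <- _ | _) _) => S; lia.
rewrite -[RHS]sumrN.
apply: (@big_box_bij _ n P P h h) => // t /hP[] //.
by move=> Ph hh ->; rewrite opprK.
Qed.

(** [hax] and [hby] are the symmetries of N = a x + 2 b (y/2) that exchange the two factors of a x
    and of b (y/2). The second one preserves the parities in [qsol] when y/2 is odd. *)
Definition hax (t : quad) : quad := let '(a, b, x, y) := t in (x, b, a, y).
Definition hby (t : quad) : quad := let '(a, b, x, y) := t in (a, y./2, x, b.*2).

Lemma qsol_box N t : qsol N t -> t \in box N.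
Proof. by case/andP => /sol_box. Qed.

Lemma qsol_hax N t : qsol N t -> qsol N (hax t).
Proof.
case: t => [[[a b] x] y]; rewrite /qsol /qa /qb /qx /qy /=.
move=> /andP[/and5P[a0 b0 x0 y0 /eqP E] /and4P[oa ob ox oy]].
by apply/andP; split; [apply/and5P; split=> //; rewrite (mulnC x) E|apply/and4P].
Qed.

Lemma qsol_hby N a b x y : qsol N (a, b, x, y) -> odd (b * y./2) ->
  qsol N (a, y./2, x, b.*2) /\ hby (a, y./2, x, b.*2) = (a, b, x, y).
Proof.
rewrite /qsol /qa /qb /qx /qy /=.
move=> /andP[/and5P[a0 b0 x0 y0 /eqP E] /and4P[oa ob ox oy]]; rewrite oddM => /andP[_ o2].
split; last by congr (_, _, _, _); [rewrite doubleK | lia].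
apply/andP; split; last by rewrite oa ox o2 odd_double.
by apply/and5P; split=> //; try lia; apply/eqP; nia.
Qed.

Definition q5 (N : nat) : pred quad := fun t =>
  qsol N t && ((qa t * qx t) %% 8 == 5)%N && (qa t < qx t)%N.

Lemma chi4_of1 a x : ((a * x) %% 4 = 1)%N -> chi4 a = chi4 x.
Proof.
move=> E; have oE : odd (a * x) by lia.
move: oE; rewrite oddM => /andP[/chi4_odd oa /chi4_odd ox].
have : chi4 (a * x) = 1 by rewrite /chi4 E.
by rewrite chi4M; case: oa => ->; case: ox => ->.
Qed.

Lemma chi4_of3 a x : ((a * x) %% 4 = 3)%N -> chi4 a = - chi4 x.
Proof.
move=> E; have oE : odd (a * x) by lia.
move: oE; rewrite oddM => /andP[/chi4_odd oa /chi4_odd ox].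
have : chi4 (a * x) = -1 by rewrite /chi4 E.
by rewrite chi4M; case: oa => ->; case: ox => ->.
Qed.

Lemma odd_sqr_mod8 a : odd a -> ((a * a) %% 8 = 1)%N.
Proof.
move=> oa; rewrite -modnMm.
have : (a %% 8 < 8)%N by rewrite ltn_mod.
have : odd (a %% 8) by lia.
by case: (a %% 8)%N => [|[|[|[|[|[|[|[|]]]]]]]].
Qed.

Lemma mod4_of_sum N u v : (N %% 8 = 7)%N -> (u + 2 * v = N)%N ->
  (u %% 8 != 5)%N -> (u %% 4 != 3)%N -> odd u -> (v %% 4 = 3)%N.
Proof.
move=> N8 E n5 n3 ou.
have u1 : (u %% 8 = 1)%N by lia.
have [k Ek] : exists k, u = (8 * k + 1)%N by exists (u %/ 8)%N; lia.
have [l El] : exists l, N = (8 * l + 7)%N by exists (N %/ 8)%N; lia.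
have -> : v = (4 * (l - k) + 3)%N by lia.
lia.
Qed.

(* The terms with a x = 3 mod 4 are cancelled by hax; those with a x = 1 mod 8
   have b (y / 2) = 3 mod 4 and are cancelled by hby. *)
Lemma chi4_sum_mod8 N : (N %% 8 = 7)%N ->
  \sum_(t <- box N | qsol N t) chi4 (qa t) * chi4 (qb t) =
  2 * \sum_(t <- box N | q5 N t) chi4 (qa t) * chi4 (qb t).
Proof.
move=> N8; rewrite (bigID (fun t => (qa t * qx t) %% 8 == 5)%N) /=.
rewrite [X in _ + X](bigID (fun t => (qa t * qx t) %% 4 == 3)%N) /=.
rewrite [X in _ + (X + _)](@sum_box_antisym N _ hax); last 2 first.
- by move=> t /andP[/andP[/qsol_box]].
- move=> t /andP[/andP[Qt n5] m3]; have Qh := qsol_hax Qt.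
  case: t Qt n5 m3 Qh => [[[a b] x] y]; rewrite /hax /qa /qb /qx /= => Qt n5 m3 Qh.
  rewrite Qh (mulnC x) n5 m3; split=> //.
  by rewrite (chi4_of3 (eqP m3)) mulNr opprK.
rewrite [X in _ + (_ + X)](@sum_box_antisym N _ hby); last 2 first.
- by move=> t /andP[/andP[/qsol_box]].
- move=> [[[a b] x] y] /andP[/andP[Qt n5] m3].
  have /andP[/and5P[a0 b0 x0 y0 /eqP E] /and4P[oa ob ox oy]] := Qt.
  rewrite /qa /qb /qx /qy /= in n5 m3 oa ob ox oy.
  have oax : odd (a * x) by rewrite oddM oa.
  have m : ((b * y./2) %% 4 = 3)%N.
    have Ey : (b * y = 2 * (b * y./2))%N by rewrite mulnCA; congr (_ * _)%N; lia.
    by rewrite Ey in E; exact: mod4_of_sum N8 E n5 m3 oax.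
  have o : odd (b * y./2) by lia.
  have [Qh Eh] := qsol_hby Qt o; split=> //; first by rewrite /hby Qh /qa /qx /= n5 m3.
  by rewrite /qa /qb /= (chi4_of3 m) mulrN opprK.
(* The case a = x is empty, an odd square being 1 and not 5 modulo 8. [hax] exchanges a < x with x <
   a and keeps the sign, since a x = 1 mod 4 gives chi4 a = chi4 x. *)
rewrite !addr0 (big_trichotomy N _ qa qx).
rewrite [X in _ + X + _]big_pred0; last first.
  move=> [[[a b] x] y]; apply/negP => /andP[/andP[/andP[_ /and4P[oa _ _ _]] m5] /eqP E].
  by move: m5; rewrite -E odd_sqr_mod8.
rewrite addr0 mulrDl mul1r; congr (_ + _).
apply: (@big_box_bij _ N _ _ hax hax).
- by move=> t /andP[/andP[/qsol_box]].
- by move=> t /andP[/andP[/qsol_box]].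
- move=> t /andP[/andP[Qt m5] lt]; have Qh := qsol_hax Qt.
  case: t Qt m5 lt Qh => [[[a b] x] y]; rewrite /q5 /hax /qa /qb /qx /= => Qt m5 lt Qh.
  rewrite Qh (mulnC x) m5 lt; split=> //.
  by rewrite (@chi4_of1 a x) //; lia.
- move=> t /andP[/andP[Qt m5] lt]; have Qh := qsol_hax Qt.
  case: t Qt m5 lt Qh => [[[a b] x] y]; rewrite /hax /qa /qb /qx /= => Qt m5 lt Qh.
  by rewrite Qh (mulnC x) m5 lt.
Qed.

Lemma sum_signs_parity (T : Type) (s : seq T) (P : pred T) (F : T -> int) :
  (forall t, P t -> F t = 1 \/ F t = -1) ->
  exists k : int, \sum_(t <- s | P t) F t = (count P s)%:Z + 2 * k.
Proof.
move=> H; elim: s => [|t s [k IH]]; first by exists 0; rewrite big_nil.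
rewrite big_cons /=; case: (boolP (P t)) => Pt; rewrite IH; last by exists k.
by case: (H t Pt) => ->; [exists k | exists (k - 1)]; rewrite PoszD; lia.
Qed.

(* Quadruples (b, x, y, z). *)
Definition wset (N : nat) : pred quad := fun t => let '(b, x, y, z) := t in
  [&& odd b, 0 < x, 0 < y, 0 < z & x * x + 4 * (y * z) + 2 * (b * b) == N]%N.

(* Zagier's involution on x^2 + 4 y z = M, with b as a parameter. *)
Definition windmill (t : quad) : quad := let '(b, x, y, z) := t in
  if (x + z < y)%N then (b, x + 2 * z, z, y - x - z)%N
  else if (x < 2 * y)%N then (b, 2 * y - x, y, x + z - y)%N
  else (b, x - 2 * y, x + z - y, y)%N.

Definition hyz (t : quad) : quad := let '(b, x, y, z) := t in (b, x, z, y).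

Lemma wset_box N t : wset N t -> t \in box N.
Proof.
case: t => [[[b x] y] z] /and5P[ob x0 y0 z0 /eqP E]; rewrite mem_box.
have b0 : (0 < b)%N by case: (b) ob.
have := leq_pmulr b b0; have := leq_pmulr x x0.
have := leq_pmulr y z0; have := leq_pmull z y0.
by move: (b * b)%N (x * x)%N (y * z)%N E => u v w E; lia.
Qed.

(** Excludes the boundaries between the branches of [windmill]. Here x is odd, so x = 2y is
    impossible; and y = x + z would give N = (y + z)^2 + 2 b^2, which is 3 modulo 8. *)
Lemma wset_nondeg N b x y z : (N %% 8 = 7)%N -> wset N (b, x, y, z) ->
  (x + z != y)%N && (x != 2 * y)%N.
Proof.
move=> N8 /and5P[ob x0 y0 z0 /eqP E].
have b8 := odd_sqr_mod8 ob.
have ox : odd x.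
  have : odd (x * x) by move: E b8; move: (x * x)%N (y * z)%N (b * b)%N => u v w; lia.
  by rewrite oddM andbb.
apply/andP; split; last by apply/eqP => Ex; move: ox; rewrite Ex; lia.
apply/eqP => Ey.
have oyz : odd (y + z) by lia.
have s8 := odd_sqr_mod8 oyz.
have Es : ((y + z) * (y + z) + 2 * (b * b) = N)%N by rewrite -E -Ey; lia.
by move: s8 b8 Es; move: ((y + z) * (y + z))%N (b * b)%N => u v; lia.
Qed.

Lemma windmillP N t : (N %% 8 = 7)%N -> wset N t ->
  wset N (windmill t) /\ windmill (windmill t) = t.
Proof.
move=> N8; case: t => [[[b x] y] z] W.
have /andP[/eqP n1 /eqP n2] := wset_nondeg N8 W.
have /and5P[ob x0 y0 z0 /eqP E] := W.
rewrite [windmill (b, x, y, z)]/windmill; case: ltnP => [c1 | c1].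
  have [k Ek] : exists k, y = (x + z + k)%N by exists (y - (x + z))%N; lia.
  subst y; have -> : (x + z + k - x - z = k)%N by lia.
  split; first by apply/and5P; split=> //; try lia; apply/eqP; rewrite -E; lia.
  rewrite /windmill /= ifF; last by apply/negP; lia.
  by rewrite ifF; [congr (_, _, _, _); lia | apply/negP; lia].
have {c1}c1 : (y < x + z)%N by lia.
have [k Ek] : exists k, (x + z = y + k)%N by exists (x + z - y)%N; lia.
have -> : (x + z - y = k)%N by lia.
case: ltnP => [c2 | c2].
  have [l El] : exists l, (2 * y = x + l)%N by exists (2 * y - x)%N; lia.
  have -> : (2 * y - x = l)%N by lia.
  have Ez : z = (y + k - x)%N by lia.
  split.
    by apply/and5P; split=> //; lia.
  rewrite /windmill /= ifF; last by apply/negP; lia.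
  by rewrite ifT; [congr (_, _, _, _); lia | lia].
have [l El] : exists l, (x = 2 * y + l)%N by exists (x - 2 * y)%N; lia.
subst x; rewrite addKn; have Ez : k = (y + l + z)%N by lia.
subst k; split; first by apply/and5P; split=> //; try lia; apply/eqP; rewrite -E; lia.
rewrite /windmill /= ifT; last by lia.
by congr (_, _, _, _); lia.
Qed.

(** The outer branches change x by a positive even number, so a fixed point lies in the middle one,
    with 2y - x = x. The projections are positional: on (b, x, y, z), [qb] reads x, [qx] reads y and
    [qy] reads z. *)
Lemma windmill_fixed N t : (N %% 8 = 7)%N -> wset N t ->
  (windmill t == t) = (qb t == qx t).
Proof.
move=> N8; case: t => [[[b x] y] z] W.
have /and5P[ob x0 y0 z0 _] := W.
rewrite /qb /qx /=; apply/eqP/eqP => [|Exy].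
  by rewrite /windmill; case: ltnP => c1; [|case: ltnP => c2]; case=> ??; lia.
by subst y; rewrite /windmill ifF ?ifT; [congr (_, _, _, _) | |apply/negP]; lia.
Qed.

(** Both counts have the parity of the whole of [wset N]: they are the fixed points of the exchange
    of y and z and of the windmill involution. *)
Lemma wset_parity N : (N %% 8 = 7)%N ->
  odd (count (fun t => wset N t && (qx t == qy t)) (box N)) =
  odd (count (fun t => wset N t && (qb t == qx t)) (box N)).
Proof.
move=> N8; transitivity (odd (count (wset N) (box N))).
  rewrite (@box_count_parity N (wset N) hyz); first last.
  - case=> [[[b x] y] z]; rewrite /wset /= => /and5P[-> -> -> -> E].
    by rewrite (mulnC z) E.
  - exact: wset_box.
  congr odd; apply: eq_count => -[[[b x] y] z] /=; congr (_ && _).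
  by rewrite /qx /qy /=; apply/eqP/eqP => [-> | [-> _]].
rewrite (@box_count_parity N (wset N) windmill); first last.
- by move=> t; exact: windmillP.
- exact: wset_box.
by congr odd; apply: eq_count => t /=; case: (boolP (wset N t)) => //= /(windmill_fixed N8) ->.
Qed.

(** For y = 2b the equation is N = a x + 2 b^2. As a x = 1 mod 4, x = a + 4z with z > 0, so N = a^2
    + 4 a z + 2 b^2, a fixed point of [windmill]. *)
Lemma count_q5 N : (N %% 8 = 7)%N ->
  count (fun t => q5 N t && (qy t == 2 * qb t)%N) (box N) =
  count (fun t => wset N t && (qb t == qx t)) (box N).
Proof.
move=> N8; rewrite -!sum1_count; apply: (@big_box_bij _ N _ _
  (fun t => let '(a, b, x, y) := t in (b, a, a, (x - a) %/ 4)%N)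
  (fun t => let '(b, x, y, z) := t in (x, b, x + 4 * z, 2 * b)%N)).
- by move=> t /andP[/andP[/andP[/qsol_box]]].
- by move=> t /andP[/wset_box].
- case=> [[[a b] x] y] /andP[/andP[/andP[/andP[/and5P[a0 b0 x0 y0 /eqP E] /and4P[oa ob ox oy]] m5] lt] yb].
  rewrite /qa /qb /qx /qy /= in oa ob ox oy m5 lt yb *.
  have m4 : (a %% 4 = x %% 4)%N.
    have /(@chi4_of1 a x) : ((a * x) %% 4 = 1)%N by move: m5; move: (a * x)%N => u; lia.
    by rewrite /chi4; repeat case: eqP => ?; lia.
  have Ex : (x = a + 4 * ((x - a) %/ 4))%N by lia.
  split=> //; last by rewrite -Ex -(eqP yb).
  rewrite eqxx andbT ob a0 /=; apply/andP; split; first by lia.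
  by move: Ex E; move: ((x - a) %/ 4)%N => z -> E; apply/eqP; rewrite -E (eqP yb); lia.
- case=> [[[b x] y] z] /andP[/and5P[ob x0 y0 z0 /eqP E]]; rewrite /qb /qx /= => /eqP xy.
  subst y; have b8 := odd_sqr_mod8 ob.
  have E' : (x * (x + 4 * z) + 2 * (b * b) = N)%N by rewrite -E; lia.
  have m5 : ((x * (x + 4 * z)) %% 8 = 5)%N.
    by move: b8 E'; move: (x * (x + 4 * z))%N (b * b)%N => u v; lia.
  have o5 : odd (x * (x + 4 * z)) by lia.
  move: (o5); rewrite oddM => /andP[odd1 odd2].
  split; last by congr (_, _, _, _); lia.
  rewrite /q5 /qsol /sol /qa /qb /qx /qy /= eqxx andbT m5 odd1 odd2 ob oddM /= !andbT.
  have b0 : (0 < b)%N by case: (b) ob.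
  by apply/andP; split; [apply/and5P; split|]; lia.
Qed.

(** Completing the square, 8 tri k + 1 = (2k+1)^2. Conversely, in x^2 + 4y^2 + 2b^2 = 7 mod 8 with b
    odd, first x and then y must be odd, so every solution with y = z arises. *)
Lemma ntri_count n : ntri n =
  count (fun t => wset (8 * n + 7) t && (qx t == qy t)) (box (8 * n + 7)).
Proof.
have [s Es] : exists s, s = iota 0 n.+1 by eexists.
pose P := fun u : nat * nat * nat => (tri u.1.1 + 2 * tri u.1.2 + 4 * tri u.2 == n)%N.
have -> : ntri n = (\sum_(u <- [seq (v, k) | v <- [seq (i, j) | i <- s, j <- s], k <- s] | P u) 1)%N.
  rewrite big_mkcond !big_allpairs /ntri /=.
  have -> : s = index_iota 0 n.+1 by rewrite Es /index_iota subn0.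
  rewrite big_mkord.
  apply: eq_bigr => i _; rewrite big_mkord; apply: eq_bigr => j _.
  by rewrite big_mkord; apply: eq_bigr => k _; rewrite /P; case: eqP.
rewrite -sum1_count -big_filter -[RHS]big_filter.
have tE k : (8 * tri k + 1 = k.*2.+1 * k.*2.+1)%N by have := double_tri k; nia.
have S k : (k \in s) = (k <= n)%N by rewrite Es mem_iota.
have uqs : uniq s by rewrite Es iota_uniq.
apply: (big_seq_bij
  (h := fun u => (u.1.2.*2.+1, u.1.1.*2.+1, u.2.*2.+1, u.2.*2.+1) : quad)
  (g := fun t : quad => ((qb t)./2, (qa t)./2, (qx t)./2))).
- by apply: filter_uniq; do 2![apply: uniq_pairs => //].
- exact: filter_uniq (box_uniq _).
- case=> [[i j] k]; rewrite mem_filter => /andP[/eqP /= E _].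
  have W : wset (8 * n + 7) (j.*2.+1, i.*2.+1, k.*2.+1, k.*2.+1).
    by apply/and5P; split=> //=; rewrite ?odd_double // -!tE; apply/eqP; lia.
  split; last by [].
  + by rewrite mem_filter W (wset_box W) /qx /qy /= eqxx.
  + by rewrite /qa /qb /qx /=; congr (_, _, _); lia.
- case=> [[[b x] y] z]; rewrite mem_filter => /andP[/andP[W]] + _.
  rewrite /qa /qb /qx /qy /= => /eqP yz; subst z.
  have /and5P[ob x0 y0 _ /eqP E] := W.
  have b8 := odd_sqr_mod8 ob.
  have ox : odd x.
    have : odd (x * x) by move: E b8; move: (x * x)%N (y * y)%N (b * b)%N => u v w; lia.
    by rewrite oddM andbb.
  have x8 := odd_sqr_mod8 ox.
  have oy : odd y.
    have : odd (y * y) by move: E b8 x8; move: (x * x)%N (y * y)%N (b * b)%N => u v w; lia.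
    by rewrite oddM andbb.
  have H m : odd m -> m./2.*2.+1 = m by lia.
  rewrite !H //; split=> //; rewrite mem_filter !mem_pairs !S /P /=.
  have := tE x./2; have := tE y./2; have := tE b./2; rewrite !H // => Eb Ey Ex.
  have ET : (tri x./2 + 2 * tri b./2 + 4 * tri y./2 = n)%N by lia.
  rewrite ET eqxx /=; have := leq_tri x./2; have := leq_tri b./2; have := leq_tri y./2.
  by lia.
Qed.

(** The three halvings show that the signed sum over [q5] is (p+1)(q+1)/8; modulo 2 it is the size
    of [q5]. There 2 b (y/2) = N - a x = 2 mod 8, so b (y/2) is odd and [hby] acts on [q5], with
    fixed points y = 2b. [count_q5] and [wset_parity] carry the parity over to [ntri]. *)
Lemma ntri_odd_pq p q n : prime p -> prime q -> (p %% 8 = 3)%N -> (q %% 8 = 5)%N ->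
  (p * q = 8 * n + 7)%N -> odd (ntri n).
Proof.
move=> pp pq p8 q8 En; have N8 : ((p * q) %% 8 = 7)%N by rewrite En; lia.
have oN : odd (p * q) by lia.
have := chi4_sum_pq pp pq p8 q8; rewrite chi4_sum_odd // chi4_sum_mod8 //.
have [k ->] := @sum_signs_parity _ (box (p * q)) (q5 (p * q)) (fun t => chi4 (qa t) * chi4 (qb t))
  (fun t Ht => ltac:(case/andP: Ht => /andP[/andP[_ /and4P[/chi4_odd oa /chi4_odd ob _ _]] _] _;
    by case: oa => ->; case: ob => ->; [left|right|right|left])).
rewrite ntri_count -En wset_parity // -count_q5 //.
rewrite [X in odd X](_ : _ = count (fun t => q5 (p * q) t && (hby t == t)) (box (p * q))); last first.
  apply: eq_count => -[[[a b] x] y] /=.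
  case: (boolP (q5 _ _)) => //= /andP[/andP[/andP[_ /and4P[_ _ _]]]]; rewrite /qy /qb /= => oy _ _.
  apply/eqP/eqP => [Ey | [Eb Ey]]; last by lia.
  by congr (_, _, _, _); lia.
rewrite -(@box_count_parity _ (q5 (p * q)) hby); last 2 first.
- by move=> t /andP[/andP[/qsol_box]].
- move=> [[[a b] x] y] /andP[/andP[Qt m5] lt].
  have /andP[/and5P[a0 b0 x0 y0 /eqP E] /and4P[oa ob ox oy]] := Qt.
  rewrite /qa /qb /qx /qy /= in m5 lt oa ob ox oy.
  have o : odd (b * y./2).
    have Ey : (b * y = 2 * (b * y./2))%N by rewrite mulnCA; congr (_ * _)%N; lia.
    by move: E N8; rewrite Ey; move: (p * q)%N (a * x)%N (b * y./2)%N m5 => N u v; lia.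
  have [Qh Eh] := qsol_hby Qt o; split=> //.
  by rewrite /q5 /hby Qh /qa /qx /= m5 lt.
move: (count _ _) => c.
(* p + 1 = 4 (2u + 1) and q + 1 = 2 (4v + 3), so an odd product is left after division by 8. *)
have [u Eu] : exists u, p = (8 * u + 3)%N by exists (p %/ 8)%N; lia.
have [v Ev] : exists v, q = (8 * v + 5)%N by exists (q %/ 8)%N; lia.
rewrite Eu Ev => H.
have {H} H : c%:Z + 2 * k = ((2 * u + 1) * (4 * v + 3))%N by lia.
have o : odd ((2 * u + 1) * (4 * v + 3)) by rewrite oddM; apply/andP; split; lia.
by move: H o; move: (_ * _)%N => w; lia.
Qed.

(** * Primes congruent to 3 and 5 modulo 8 *)

Lemma prime_dvd_fact p n : prime p -> (p %| n`!)%N = (p <= n)%N.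
Proof.
move=> pp; apply/idP/idP => [|pn]; last by apply: dvdn_fact; rewrite prime_gt0.
elim: n => [|n IH]; first by rewrite fact0 dvdn1 => /eqP p1; rewrite p1 in pp.
rewrite factS Euclid_dvdM // => /orP[/dvdn_leq -> // | /IH pn].
exact: leq_trans pn (leqnSn n).
Qed.

Lemma prod_primes_dvdn (s : seq nat) k : uniq s -> all prime s ->
  (forall p, p \in s -> (p %| k)%N) -> (\prod_(p <- s) p %| k)%N.
Proof.
elim: s => [|p s IH] /=; first by rewrite big_nil dvd1n.
move=> /andP[ps us] /andP[pp as_] dk; rewrite big_cons Gauss_dvd.
  by rewrite dk ?mem_head //= IH // => q qs; apply: dk; rewrite inE qs orbT.
rewrite prime_coprime //; apply/negP; rewrite big_seq Euclid_dvd_prod //.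
rewrite big_has_cond => /hasP[q qs /andP[_]].
have pq : prime q := allP as_ q qs.
rewrite dvdn_prime2 // => /eqP E.
by move: ps; rewrite E qs.
Qed.

Lemma bin_odd_mid_le m : ('C(m.*2.+1, m) <= 4 ^ m)%N.
Proof.
have E : 'C(m.*2.+1, m.+1) = 'C(m.*2.+1, m).
  by rewrite -[RHS]bin_sub; [congr 'C(_, _) |]; lia.
have : ('C(m.*2.+1, m) + 'C(m.*2.+1, m.+1) <= 2 ^ m.*2.+1)%N.
  rewrite -[2%N]/(1 + 1)%N expnDn.
  have m1 : (m < m.*2.+2)%N by lia.
  have m2 : (m.+1 < m.*2.+2)%N by lia.
  rewrite (bigD1 (Ordinal m1)) //= (bigD1 (Ordinal m2)) /=; last first.
    by apply/eqP => /(congr1 val) /=; lia.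
  by rewrite !exp1n !muln1 addnA leq_addr.
rewrite E expnS -mul2n expnM (_ : 2 ^ 2 = 4)%N //; lia.
Qed.

(** Erdos's induction: for n = 2m + 1 the primes in [m + 2, n] divide the binomial coefficient
    C(2m+1, m), at most 4^m, and the others contribute at most 4^(m+1). An even n > 2 is not
    prime. *)
Lemma primorial_le n : (\prod_(0 <= p < n.+1 | prime p) p <= 4 ^ n)%N.
Proof.
elim/ltn_ind: n => n IH.
have [n2 | n2] := leqP n 2.
  by case: n n2 {IH} => [|[|[|]]] // _; rewrite unlock.
have [on | en] := boolP (odd n); last first.
  case: n n2 en IH => // n n2 en IH; rewrite big_mkcond big_nat_recr //= -big_mkcond /=.
  have -> : prime n.+1 = false.
    by apply/negP => /even_prime[]; [lia | move: en => /negbTE ->].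
  by rewrite muln1 (leq_trans (IH n _)) // leq_exp2l.
have [m Em] : exists m, n = m.*2.+1 by exists n./2; lia.
have m1 : (m.+2 <= n.+1)%N by lia.
rewrite (@big_cat_nat _ _ _ m.+2) //=.
have D : (\prod_(m.+2 <= p < n.+1 | prime p) p <= 'C(m.*2.+1, m))%N.
  apply: dvdn_leq; first by rewrite bin_gt0; lia.
  rewrite -big_filter; apply: prod_primes_dvdn.
  - exact: filter_uniq (iota_uniq _ _).
  - exact: filter_all.
  move=> p; rewrite mem_filter mem_index_iota => /andP[pp /andP[p1 p2]].
  have F : ('C(m.*2.+1, m) * (m`! * m.+1`!) = (m.*2.+1)`!)%N.
    by rewrite -(@bin_fact m.*2.+1 m); [congr (_ * (_ * _`!))%N|]; lia.
  have : (p %| (m.*2.+1)`!)%N by rewrite prime_dvd_fact //; lia.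
  rewrite -F Euclid_dvdM // (Euclid_dvdM m`! m.+1`! pp) !prime_dvd_fact //.
  by case/or3P => // pm; have := leq_trans p1 pm; clear; lia.
apply: leq_trans (leq_mul (IH m.+1 _) D) _; first by lia.
apply: leq_trans (leq_mul (leqnn _) (bin_odd_mid_le m)) _.
by rewrite -expnD leq_exp2l //; lia.
Qed.

Lemma ln_nat_ge0 (R : realType) n : 0 <= ln n%:R :> R.
Proof. by case: n => [|n]; [rewrite ln0 | rewrite ln_ge0 // ler1n]. Qed.

Lemma ler_ln_nat (R : realType) m n : (0 < m <= n)%N -> ln m%:R <= ln n%:R :> R.
Proof. by move=> /andP[m0 mn]; rewrite ler_ln ?posrE ?ltr0n ?ler_nat // (leq_trans m0). Qed.

Lemma ln_prod_nat (R : realType) (I : Type) (r : seq I) (P : pred I) (F : I -> nat) :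
  (forall i, P i -> (0 < F i)%N) ->
  ln (\prod_(i <- r | P i) F i)%N%:R = \sum_(i <- r | P i) ln (F i)%:R :> R.
Proof.
move=> F0; suff [] : (0 < \prod_(i <- r | P i) F i)%N /\
  ln (\prod_(i <- r | P i) F i)%N%:R = \sum_(i <- r | P i) ln (F i)%:R :> R by [].
elim/big_rec2: _ => [|i y z Pi [z0 IH]]; first by rewrite ln1.
by rewrite muln_gt0 F0 // natrM lnM ?posrE ?ltr0n ?F0 // IH.
Qed.

Definition theta (R : realType) (n : nat) : R := \sum_(0 <= p < n.+1 | prime p) ln p%:R.

Lemma theta_le (R : realType) n : theta R n <= 4 * n%:R.
Proof.
rewrite /theta -(@ln_prod_nat R _ _ _ id) /=; last by move=> p /prime_gt0.
have p0 : (0 < \prod_(0 <= p < n.+1 | prime p) p)%N by rewrite prodn_cond_gt0 // => p /prime_gt0.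
apply: (@le_trans _ _ (ln (4 ^ n)%N%:R)); first by rewrite ler_ln_nat // p0 primorial_le.
by rewrite natrX lnXn ?ltr0n // -[X in X <= _]mulr_natr ler_wpM2r ?ler0n // ltW // ln_sublinear ?ltr0n.
Qed.

Lemma sum_multiples (V : nmodType) (g : nat -> V) d n : (0 < d)%N ->
  \sum_(1 <= m < n.+1 | (d %| m)%N) g m = \sum_(1 <= j < (n %/ d).+1) g (d * j)%N.
Proof.
move=> d0; elim: n => [|n IH]; first by rewrite div0n !big_geq.
rewrite big_mkcond big_nat_recr //= -big_mkcond IH divnS //.
have [dn | _] := boolP (d %| n.+1)%N; last by rewrite add0n addr0.
rewrite add1n [RHS]big_nat_recr //=; congr (_ + g _).
have <- : (n.+1 %/ d = (n %/ d).+1)%N by rewrite divnS // dn.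
by rewrite mulnC divnK.
Qed.

(** The convolution identity ln = Lambda * 1 for von Mangoldt's function. The ranges of p and k are
    extended to n, independently of m, so that sums can be exchanged in [sum_ln_pfactor]. *)
Lemma ln_sum_pfactor (R : realType) m n : (0 < m <= n)%N ->
  ln m%:R = \sum_(0 <= p < n.+1 | prime p)
    \sum_(1 <= k < n.+1 | (p ^ k %| m)%N) ln p%:R :> R.
Proof.
move=> /andP[m0 mn].
have E p : prime p -> \sum_(1 <= k < n.+1 | (p ^ k %| m)%N) ln p%:R = (logn p m)%:R * ln p%:R :> R.
  move=> pp; have L : (logn p m <= n)%N.
    by apply: leq_trans mn; apply: ltnW; exact: ltn_logl.
  rewrite big_mkcond (@big_cat_nat _ _ _ (logn p m).+1) //=.
  rewrite [X in _ + X]big_nat_cond [X in _ + X]big1 ?addr0; last first.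
    by move=> k /andP[/andP[k1 _] _]; rewrite pfactor_dvdn // leqNgt k1.
  rewrite (eq_big_nat _ _ (F2 := fun=> ln p%:R)); last first.
    by move=> k /andP[_ k1]; rewrite pfactor_dvdn // -ltnS k1.
  by rewrite sumr_const_nat subn1 mulr_natl.
rewrite (eq_bigr _ E) -[in LHS](partnT m0) /partn.
rewrite (ln_prod_nat R); last by move=> p _; rewrite expn_gt0; case: p => //=; rewrite lognE.
rewrite [RHS](@big_cat_nat _ _ _ m.+1) //= [X in _ + X]big_nat_cond [X in _ + X]big1 ?addr0.
  rewrite [RHS]big_mkcond; apply: eq_bigr => p _; case: ifP => pp.
    by rewrite natrX lnXn ?ltr0n ?prime_gt0 // mulr_natl.
  by rewrite lognE pp expn0 ln1.
move=> p /andP[/andP[p1 _] pp].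
by rewrite (_ : logn p m = 0%N) ?mul0r //; apply/eqP; rewrite -leqn0 leqNgt logn_gt0 mem_primes pp m0
  /=; apply: contraL p1 => /dvdn_leq; lia.
Qed.

Lemma sum_ln_pfactor (R : realType) (g : nat -> R) n :
  \sum_(1 <= m < n.+1) g m * ln m%:R =
  \sum_(0 <= p < n.+1 | prime p) \sum_(1 <= k < n.+1)
    ln p%:R * \sum_(1 <= j < (n %/ p ^ k).+1) g (p ^ k * j)%N.
Proof.
rewrite (eq_big_nat _ _ (F2 := fun m => \sum_(0 <= p < n.+1 | prime p)
    \sum_(1 <= k < n.+1) if (p ^ k %| m)%N then g m * ln p%:R else 0)); last first.
  move=> m mn; rewrite (@ln_sum_pfactor R m n) // mulr_sumr; apply: eq_bigr => p _.
  by rewrite mulr_sumr -big_mkcond.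
rewrite exchange_big /=; apply: eq_bigr => p pp; rewrite exchange_big /=.
apply: eq_bigr => k _; rewrite -sum_multiples ?expn_gt0 ?prime_gt0 // mulr_sumr.
by rewrite [RHS]big_mkcond; apply: eq_bigr => m _; case: ifP => // _; rewrite mulrC.
Qed.

(** * Bounds for sums and Abel summation *)

Lemma ln_succ_sub_le (R : realType) m : (0 < m)%N -> ln m.+1%:R - ln m%:R <= m%:R^-1 :> R.
Proof.
move=> m0; have m0' : 0 < m%:R :> R by rewrite ltr0n.
rewrite -ln_div ?posrE ?ltr0n // (_ : _ / _ = 1 + m%:R^-1); last first.
  by rewrite -natr1 mulrDl divff ?gt_eqF // mul1r.
by apply: le_ln1Dx; apply: lt_le_trans (_ : 0 <= _); rewrite ?ltrN10 ?invr_ge0 ?ler0n.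
Qed.

Lemma sum_ln_sqr_le (R : realType) n :
  \sum_(1 <= m < n.+1) ln m%:R / m%:R ^+ 2 <= 2 :> R.
Proof.
case: n => [|n]; first by rewrite big_geq.
(* Modelled on the tail integral (ln t + 1)/t of ln t / t^2, with 2 in place of 1 so that the
   induction works from the start, where ln t / t^2 is not yet decreasing. *)
suff H : \sum_(1 <= m < n.+2) ln m%:R / m%:R ^+ 2 <= 2 - (ln n.+1%:R + 2) / n.+1%:R :> R.
  by apply: le_trans H _; rewrite gerBl divr_ge0 ?ler0n // addr_ge0 ?ln_nat_ge0.
elim: n => [|n IH]; first by rewrite big_nat1 ln1; lra.
rewrite big_nat_recr //=; apply: le_trans (lerD IH (lexx _)) _.
have Hl := ln_succ_sub_le R (ltn0Sn n).
have L0 := ln_nat_ge0 R n.+2.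
have x1 : 1 <= n.+1%:R :> R by rewrite ler1n.
have -> : n.+2%:R = n.+1%:R + 1 :> R by rewrite natr1.
move: Hl L0; rewrite -[n.+2%:R]natr1.
move: (ln (n.+1%:R + 1)) (ln n.+1%:R) => L l Hl L0.
move: (n.+1%:R) x1 Hl => x x1 Hl.
have xp : 0 < x by apply: lt_le_trans x1.
have x0 : x != 0 by rewrite gt_eqF.
have x10 : x + 1 != 0 by rewrite gt_eqF // addr_gt0.
have H1 : (L - x^-1 + 2) / x <= (l + 2) / x.
  apply: ler_wpM2r; first by rewrite invr_ge0 ltW.
  by rewrite lerD2r lerBlDr -lerBlDl.
have H2 : (L - x^-1 + 2) / x - (L + 2) / (x + 1) - L / (x + 1) ^+ 2 =
    (L * x + (x ^+ 2 - 1)) / (x ^+ 2 * (x + 1) ^+ 2).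
  by field; rewrite x0 x10.
have H3 : 0 <= (L * x + (x ^+ 2 - 1)) / (x ^+ 2 * (x + 1) ^+ 2).
  apply: divr_ge0; last by rewrite mulr_ge0 // sqr_ge0.
  nra.
lra.
Qed.

Lemma abel_le (R : realType) (chi w : nat -> R) u v : (u <= v)%N ->
  (forall i j, `|\sum_(i <= m < j) chi m| <= 2) ->
  (forall m, (u <= m)%N -> 0 <= w m) ->
  (forall m, (u <= m)%N -> w m.+1 <= w m) ->
  `|\sum_(u <= m < v) chi m * w m| <= 2 * w u.
Proof.
move=> uv chi2 w0 wd; pose D k := \sum_(u <= m < k) chi m.
have E : \sum_(u <= m < v) chi m * w m =
    D v * w v + \sum_(u <= m < v) D m.+1 * (w m - w m.+1).
  elim: v uv => [|v IH]; first by rewrite leqn0 => /eqP ->; rewrite /D !big_geq // mul0r addr0.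
  rewrite leq_eqVlt => /orP[/eqP <- | uv]; first by rewrite /D !big_geq // mul0r addr0.
  rewrite [in LHS]big_nat_recr //= IH // [in RHS]big_nat_recr //=.
  have -> : D v.+1 = D v + chi v by rewrite /D big_nat_recr.
  ring.
rewrite E; apply: le_trans (ler_normD _ _) _.
have -> : 2 * w u = 2 * w v + \sum_(u <= m < v) 2 * (w m - w m.+1).
  rewrite -mulr_sumr -mulrDr; congr (_ * _).
  rewrite (@telescope_sumr_eq _ _ _ (fun k => - w k)) //; last by move=> k _; rewrite opprK addrC.
  ring.
apply: lerD.
  by rewrite normrM ler_pM // ?chi2 // ger0_norm ?w0.
apply: le_trans (ler_norm_sum _ _ _) _.
rewrite [X in X <= _]big_nat_cond [X in _ <= X]big_nat_cond; apply: ler_sum => m /andP[/andP[um _] _].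
by rewrite normrM ler_pM // ?chi2 // ger0_norm // subr_ge0 wd.
Qed.

Lemma geom_tail_le (R : realType) (x : R) n : 0 <= x -> x <= 2^-1 ->
  \sum_(2 <= k < n.+1) x ^+ k <= 2 * x ^+ 2.
Proof.
move=> x0 x2; case: n => [|[|n]]; try by rewrite big_geq // mulr_ge0 // exprn_ge0.
suff H : \sum_(2 <= k < n.+3) x ^+ k <= 2 * x ^+ 2 - 2 * x ^+ n.+3.
  by apply: le_trans H _; rewrite gerBl mulr_ge0 // exprn_ge0.
elim: n => [|n IH].
  rewrite big_nat1 [x ^+ 3]exprS; have := exprn_ge0 2 x0; nra.
rewrite big_nat_recr //=; have := exprn_ge0 n.+3 x0; rewrite [x ^+ n.+4]exprS; nra.
Qed.

(** What Mertens' argument uses of a real character. The last clause is L(1, chi) > 0 in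
    quantitative form, stated for partial sums to avoid infinite series. *)
Definition is_char (R : realType) (chi : nat -> R) : Prop :=
  [/\ forall a b, chi (a * b)%N = chi a * chi b,
      forall a, `|chi a| <= 1,
      forall i j, `|\sum_(i <= m < j) chi m| <= 2 &
      forall n, (8 <= n)%N -> 4^-1 <= \sum_(1 <= m < n.+1) chi m / m%:R].

Lemma char_sum_ln_le (R : realType) (chi : nat -> R) n : is_char chi ->
  `|\sum_(1 <= m < n.+1) chi m / m%:R * ln m%:R| <= 4.
Proof.
case=> _ _ chi2 _.
(* ln m / m increases at first, but (1 + ln m)/m decreases from m = 1 on, so Abel summation applies
   to it and to 1/m separately. *)
have E : \sum_(1 <= m < n.+1) chi m / m%:R * ln m%:R =
    \sum_(1 <= m < n.+1) chi m * ((1 + ln m%:R) / m%:R) - \sum_(1 <= m < n.+1) chi m * m%:R^-1.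
  by rewrite -sumrB; apply: eq_bigr => m _; ring.
rewrite E; apply: le_trans (ler_normB _ _) _.
have -> : 4 = 2 * ((1 + ln 1%:R) / 1%:R) + 2 * 1%:R^-1 :> R by rewrite ln1; lra.
apply: lerD;
  [apply: (@abel_le R chi (fun m => (1 + ln m%:R) / m%:R)) => // m m1
  |apply: (@abel_le R chi (fun m => m%:R^-1)) => // m m1].
- by rewrite mulr_ge0 ?invr_ge0 ?ler0n // addr_ge0 ?ler01 ?ln_nat_ge0.
- have m0 : 0 < m%:R :> R by rewrite ltr0n.
  have := ln_succ_sub_le R m1; set l := ln m%:R; set l' := ln m.+1%:R => Hl.
  have l0 : 0 <= l by exact: ln_nat_ge0.
  rewrite ler_pdivrMr ?ltr0n // mulrAC ler_pdivlMr // -natr1.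
  have : m%:R * (l' - l) <= 1 by rewrite mulrC -ler_pdivlMr // mul1r.
  nra.
- by rewrite lef_pV2 ?posrE ?ltr0n // ler_nat.
Qed.

Lemma sum_prime_tail_le (R : realType) n :
  \sum_(0 <= p < n.+1 | prime p) \sum_(2 <= k < n.+1) ln p%:R / p%:R ^+ k <= 4 :> R.
Proof.
have H p : prime p -> \sum_(2 <= k < n.+1) ln p%:R / p%:R ^+ k <= 2 * (ln p%:R / p%:R ^+ 2) :> R.
  move=> pp; have p0 := ln_nat_ge0 R p.
  under eq_bigr => k _ do rewrite -exprVn.
  rewrite -mulr_sumr mulrCA -exprVn ler_wpM2l // geom_tail_le ?invr_ge0 ?ler0n //.
  by rewrite lef_pV2 ?posrE ?ltr0n ?prime_gt0 // ler_nat prime_gt1.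
apply: le_trans (ler_sum _ H) _; rewrite -mulr_sumr.
rewrite (_ : 4 = 2 * 2) ?ler_pM2l //; last by lra.
apply: le_trans (sum_ln_sqr_le R n).
rewrite big_mkcond big_ltn //= add0r; apply: ler_sum => p _.
by case: ifP => // _; rewrite divr_ge0 ?ln_nat_ge0 // exprn_ge0.
Qed.

(** * Mertens sums twisted by a real character *)

Definition char_prime_sum (R : realType) (chi : nat -> R) (n : nat) : R :=
  \sum_(0 <= p < n.+1 | prime p) chi p * (ln p%:R / p%:R).

(** Expanding ln m over prime powers turns the bounded sum of chi(m) ln m / m into the sum of chi(p)
    (ln p / p) A(n/p) plus higher powers. Replacing A(n/p) by A(n) costs at most 2p/n for each
    prime, in total 2 theta(n)/n <= 8. With 8 for the higher powers and 4 for the left side this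
    makes 20, and A(n) >= 1/4 gives 80. *)
Lemma char_prime_sum_le (R : realType) (chi : nat -> R) n : is_char chi -> (8 <= n)%N ->
  `|char_prime_sum chi n| <= 80.
Proof.
move=> chiP n8; case: (chiP) => chiM chi1 chi2 chiA.
pose A y := \sum_(1 <= m < y.+1) chi m / m%:R.
have An : 4^-1 <= A n by exact: chiA.
have Ay y : `|A y| <= 2.
  rewrite -[2]mulr1 -[X in _ * X]invr1.
  apply: (@abel_le R chi (fun m => m%:R^-1)) => // m m1.
  by rewrite lef_pV2 ?posrE ?ltr0n // ler_nat.
have n0 : 0 < n%:R :> R by rewrite ltr0n; lia.
pose B := \sum_(0 <= p < n.+1 | prime p) \sum_(2 <= k < n.+1)
  ln p%:R * (chi (p ^ k)%N / (p ^ k)%N%:R * A (n %/ p ^ k)%N).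
have E : A n * char_prime_sum chi n =
    \sum_(0 <= p < n.+1 | prime p) chi p * (ln p%:R / p%:R) * (A n - A (n %/ p)%N)
    + \sum_(1 <= m < n.+1) chi m / m%:R * ln m%:R - B.
  have -> : \sum_(1 <= m < n.+1) chi m / m%:R * ln m%:R =
      \sum_(0 <= p < n.+1 | prime p) chi p * (ln p%:R / p%:R) * A (n %/ p)%N + B.
    rewrite sum_ln_pfactor -big_split /=; apply: eq_bigr => p pp.
    have F k : ln p%:R * (\sum_(1 <= j < (n %/ p ^ k).+1) chi (p ^ k * j)%N / (p ^ k * j)%N%:R) =
        ln p%:R * (chi (p ^ k)%N / (p ^ k)%N%:R * A (n %/ p ^ k)%N).
      congr (_ * _); rewrite mulr_sumr; apply: eq_bigr => j _.
      by rewrite chiM natrM invfM; ring.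
    rewrite big_ltn; last by lia.
    by rewrite F expn1; congr (_ + _); [ring | apply: eq_bigr => k _; rewrite F].
  rewrite addrA addrK -big_split /= mulr_sumr; apply: eq_bigr => p _; ring.
have H1 : `|\sum_(0 <= p < n.+1 | prime p) chi p * (ln p%:R / p%:R) * (A n - A (n %/ p)%N)| <= 8.
  apply: le_trans (ler_norm_sum _ _ _) _.
  apply: (@le_trans _ _ (\sum_(0 <= p < n.+1 | prime p) 2 / n%:R * ln p%:R)).
    apply: ler_sum => p pp.
    have p0 : 0 < p%:R :> R by rewrite ltr0n prime_gt0.
    have lp := ln_nat_ge0 R p.
    have AA : `|A n - A (n %/ p)%N| <= 2 * (p%:R / n%:R).
      have -> : A n - A (n %/ p)%N = \sum_((n %/ p).+1 <= m < n.+1) chi m * m%:R^-1.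
        rewrite /A (@big_cat_nat _ _ _ (n %/ p).+1 1 n.+1) //=; last by rewrite ltnS leq_div.
        by rewrite addrAC subrr add0r.
      apply: le_trans (@abel_le R chi (fun m => m%:R^-1) _ _ _ chi2 _ _) _ => //.
      - by rewrite ltnS leq_div.
      - by case=> // m _; rewrite lef_pV2 ?posrE ?ltr0n ?ler_nat.
      rewrite ler_pM2l // -[p%:R / n%:R]invrK invf_div lef_pV2 ?posrE ?divr_gt0 ?ltr0Sn //.
      rewrite ler_pdivrMr // -natrM ler_nat ltnW //.
      exact: ltn_ceil (prime_gt0 pp).
    rewrite !normrM [ `|ln _|]ger0_norm // [ `|p%:R^-1|]ger0_norm; last by rewrite invr_ge0 ltW.
    apply: (@le_trans _ _ (1 * (ln p%:R / p%:R) * (2 * (p%:R / n%:R)))).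
      have lp0 : 0 <= ln p%:R / p%:R :> R by rewrite divr_ge0 // ltW.
      by apply: ler_pM => //; [rewrite mulr_ge0 | apply: ler_wpM2r].
    by rewrite le_eqVlt; apply/orP; left; apply/eqP; field; rewrite !gt_eqF.
  rewrite -mulr_sumr mulrAC ler_pdivrMr //.
  by have := theta_le R n; rewrite /theta; lra.
have H2 : `|B| <= 8.
  apply: le_trans (ler_norm_sum _ _ _) _.
  apply: (@le_trans _ _ (2 * \sum_(0 <= p < n.+1 | prime p) \sum_(2 <= k < n.+1) ln p%:R / p%:R ^+ k)).
    rewrite mulr_sumr; apply: ler_sum => p pp.
    apply: le_trans (ler_norm_sum _ _ _) _; rewrite mulr_sumr; apply: ler_sum => k _.
    have lp := ln_nat_ge0 R p.
    rewrite !normrM ger0_norm // -natrX [ `|_^-1|]ger0_norm ?invr_ge0 ?ler0n //.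
    have i0 : 0 <= (p ^ k)%N%:R^-1 :> R by rewrite invr_ge0 ler0n.
    rewrite [X in _ <= X]mulrCA; apply: ler_wpM2l => //.
    rewrite [X in _ <= X]mulrC; apply: ler_pM => //.
    by rewrite -[X in _ <= X]mul1r; apply: ler_wpM2r.
  by have := sum_prime_tail_le R n; lra.
have H3 := char_sum_ln_le n chiP.
have H : A n * `|char_prime_sum chi n| <= 20.
  rewrite -[A n in X in X <= _]ger0_norm; last by lra.
  rewrite -normrM E; apply: le_trans (ler_normB _ _) _.
  apply: le_trans (lerD (ler_normD _ _) (lexx _)) _; lra.
have := normr_ge0 (char_prime_sum chi n); nra.
Qed.

(** * Mertens' theorem for all primes *)

Definition prime_sum (R : realType) (n : nat) : R :=
  \sum_(0 <= p < n.+1 | prime p) ln p%:R / p%:R.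

Lemma sum_ln_bounds (R : realType) n : (0 < n)%N ->
  (n%:R * ln n%:R - n%:R <= \sum_(1 <= m < n.+1) ln m%:R :> R) &&
  (\sum_(1 <= m < n.+1) ln m%:R <= n%:R * ln n%:R :> R).
Proof.
case: n => // n _; elim: n => [|n /andP[IH1 IH2]].
  by rewrite big_nat1 ln1 mulr0 lexx andbT sub0r oppr_le0 ler0n.
rewrite big_nat_recr //=.
have x1 : 1 <= n.+1%:R :> R by rewrite ler1n.
have Hl := ln_succ_sub_le R (ltn0Sn n).
have Hm : ln n.+1%:R <= ln n.+2%:R :> R by apply: ler_ln_nat; rewrite leqnSn.
have Hx : n.+1%:R * (ln n.+2%:R - ln n.+1%:R) <= 1 :> R.
  by rewrite mulrC -ler_pdivlMr ?mul1r // ltr0n.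
have -> : n.+2%:R = n.+1%:R + 1 :> R by rewrite natr1.
move: IH1 IH2 Hm Hx; rewrite -[in ln n.+2%:R]natr1.
move: (ln (n.+1%:R + 1)) (ln n.+1%:R) (\sum_(_ <= _ < _) _) x1 => L l S.
by move: (n.+1%:R) => x x1 IH1 IH2 Hm Hx; apply/andP; split; nra.
Qed.

(** Expand ln n! over prime powers and divide by n. The lower constant 5 is 1 from the estimate of
    ln n! plus 4 from the powers with k >= 2; the upper constant 4 is theta(n)/n, the cost of the
    integer parts. *)
Lemma mertens (R : realType) n : (0 < n)%N ->
  ln n%:R - 5 <= prime_sum R n <= ln n%:R + 4.
Proof.
move=> n0; have n0' : 0 < n%:R :> R by rewrite ltr0n.
have /andP[L1 L2] := sum_ln_bounds R n0.
have E : \sum_(1 <= m < n.+1) ln m%:R =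
    \sum_(0 <= p < n.+1 | prime p) \sum_(1 <= k < n.+1) ln p%:R * (n %/ p ^ k)%N%:R :> R.
  rewrite -(eq_bigr _ (fun m _ => mul1r (ln m%:R))) (@sum_ln_pfactor R (fun=> 1)).
  apply: eq_bigr => p _; apply: eq_bigr => k _; congr (_ * _).
  by rewrite sumr_const_nat subn1.
have divle (d : nat) : (0 < d)%N -> (n %/ d)%N%:R <= n%:R / d%:R :> R.
  by move=> d0; rewrite ler_pdivlMr ?ltr0n // -natrM ler_nat leq_divM.
have divge (d : nat) : (0 < d)%N -> n%:R / d%:R - 1 <= (n %/ d)%N%:R :> R.
  move=> d0; rewrite lerBlDr ler_pdivrMr ?ltr0n // natr1 -natrM ler_nat ltnW //.
  exact: ltn_ceil.
have H1 : \sum_(1 <= m < n.+1) ln m%:R <= n%:R * (prime_sum R n + 4).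
  rewrite E mulrDr; have T := sum_prime_tail_le R n.
  apply: (@le_trans _ _ (n%:R * prime_sum R n + n%:R * (\sum_(0 <= p < n.+1 | prime p)
      \sum_(2 <= k < n.+1) ln p%:R / p%:R ^+ k))); last by rewrite lerD2l ler_pM2l.
  rewrite /prime_sum -mulrDr -big_split /= mulr_sumr; apply: ler_sum => p pp.
  have lp := ln_nat_ge0 R p; rewrite big_ltn // mulrDr; apply: lerD.
    by rewrite expn1 mulrCA; apply: ler_wpM2l => //; apply: divle; exact: prime_gt0.
  rewrite mulr_sumr; apply: ler_sum => k _; rewrite mulrCA; apply: ler_wpM2l => //.
  by rewrite -natrX; apply: divle; rewrite expn_gt0 prime_gt0.
have H2 : n%:R * prime_sum R n - theta R n <= \sum_(1 <= m < n.+1) ln m%:R.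
  rewrite E /prime_sum /theta mulr_sumr -sumrB; apply: ler_sum => p pp.
  have lp := ln_nat_ge0 R p; rewrite big_ltn // expn1.
  apply: (@le_trans _ _ (ln p%:R * (n %/ p)%N%:R)).
    rewrite mulrCA -[X in _ - X]mulr1 -mulrBr; apply: ler_wpM2l => //.
    by apply: divge; exact: prime_gt0.
  by rewrite lerDl; apply: sumr_ge0 => k _; rewrite mulr_ge0 // ler0n.
have T := theta_le R n.
by apply/andP; split; rewrite -(ler_pM2l n0'); nra.
Qed.

(** * Real characters modulo 8 *)

Definition chr8 (R : realType) (t : seq int) (m : nat) : R := (t`_(m %% 8))%:~R.

(* The table s lists the partial sums of t, which are periodic as well. *)
Lemma chr8_is_char (R : realType) (t s : seq int) :
  all (fun i => all (fun j => t`_((i * j) %% 8) == t`_i * t`_j) (iota 0 8)) (iota 0 8) ->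
  all (fun i => `|t`_i| <= 1) (iota 0 8) ->
  s`_0 = 0 ->
  all (fun i => s`_(i.+1 %% 8) == s`_i + t`_i) (iota 0 8) ->
  all (fun i => all (fun j => `|s`_j - s`_i| <= 2) (iota 0 8)) (iota 0 8) ->
  4^-1 + 2 / 9 <= \sum_(1 <= m < 9) chr8 R t m / m%:R ->
  is_char (chr8 R t).
Proof.
move=> /allP tM /allP t1 s0 /allP ss /allP s2 tA.
have I8 m : (m %% 8)%N \in iota 0 8 by rewrite mem_iota /= ltn_mod.
have S v : \sum_(0 <= m < v) chr8 R t m = (s`_(v %% 8))%:~R.
  elim: v => [|v IH]; first by rewrite big_geq // mod0n s0.
  rewrite big_nat_recr //= IH -intrD; congr (_%:~R).
  by rewrite -(eqP (ss _ (I8 v))) -addn1 modnDml addn1.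
have chi2 i j : `|\sum_(i <= m < j) chr8 R t m| <= 2.
  have [ji | ij] := leqP j i; first by rewrite big_geq // normr0.
  have E : \sum_(i <= m < j) chr8 R t m = (s`_(j %% 8) - s`_(i %% 8))%:~R.
    rewrite rmorphB /= -!S (@big_cat_nat _ _ _ i 0 j) ?(ltnW ij) //=.
    by rewrite addrAC subrr add0r.
  rewrite E -intr_norm -[2]/(2%:~R) ler_int.
  by have /allP := s2 _ (I8 i); apply.
split=> //.
- move=> a b; rewrite /chr8 -intrM; congr (_%:~R).
  have /allP H := tM _ (I8 a).
  by rewrite -(eqP (H _ (I8 b))) modnMm.
- by move=> a; rewrite /chr8 -intr_norm -[1]/(1%:~R) ler_int; exact: t1.
move=> n n8; rewrite (@big_cat_nat _ _ _ 9 1 n.+1) //=.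
(* The tail loses at most 2/9, which is the surplus over 1/4 demanded of the first eight terms. *)
have : `|\sum_(9 <= m < n.+1) chr8 R t m * m%:R^-1| <= 2 * 9%:R^-1.
  apply: (@abel_le R (chr8 R t) (fun m => m%:R^-1)) => //.
  by case=> // m _; rewrite lef_pV2 ?posrE ?ltr0n ?ler_nat.
rewrite ler_norml => /andP[H _]; lra.
Qed.

(** The Kronecker symbols of discriminant -4, 8 and -8 ([t4], [t8], [tm8]): with the principal
    character, all characters modulo 8. *)
Definition t4 : seq int := [:: 0; 1; 0; -1; 0; 1; 0; -1].
Definition t8 : seq int := [:: 0; 1; 0; -1; 0; -1; 0; 1].
Definition tm8 : seq int := [:: 0; 1; 0; 1; 0; -1; 0; -1].

Lemma t4_is_char (R : realType) : is_char (chr8 R t4).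
Proof.
apply: (@chr8_is_char R _ [:: 0; 0; 1; 1; 0; 0; 1; 1]) => //.
do 8![rewrite big_ltn //]; rewrite big_geq //.
rewrite /chr8 modnn !modn_small //=; lra.
Qed.

Lemma t8_is_char (R : realType) : is_char (chr8 R t8).
Proof.
apply: (@chr8_is_char R _ [:: 0; 0; 1; 1; 0; 0; -1; -1]) => //.
do 8![rewrite big_ltn //]; rewrite big_geq //.
rewrite /chr8 modnn !modn_small //=; lra.
Qed.

Lemma tm8_is_char (R : realType) : is_char (chr8 R tm8).
Proof.
apply: (@chr8_is_char R _ [:: 0; 0; 1; 1; 2; 2; 1; 1]) => //.
do 8![rewrite big_ltn //]; rewrite big_geq //.
rewrite /chr8 modnn !modn_small //=; lra.
Qed.

Definition prime_sum_mod8 (R : realType) (a n : nat) : R :=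
  \sum_(0 <= p < n.+1 | prime p && (p %% 8 == a)%N) ln p%:R / p%:R.

(** Orthogonality of the four characters; the principal one gives the sum over all primes without p
    = 2. The errors add up to at most 3 * 80 + 5 + 1 = 246. *)
Lemma mertens_mod8 (R : realType) a n : (a = 3 \/ a = 5)%N -> (8 <= n)%N ->
  `|4 * prime_sum_mod8 R a n - ln n%:R| <= 250.
Proof.
move=> a35 n8.
pose e (t : seq int) : R := (t`_a)%:~R.
have e1 t : t \in [:: t4; t8; tm8] -> `|e t| <= 1.
  by rewrite !inE /e => /or3P[] /eqP ->; case: a35 => -> /=; rewrite ?normrN ?normr1.
have E : 4 * prime_sum_mod8 R a n = prime_sum R n - ln 2%:R / 2%:R +
    e t4 * char_prime_sum (chr8 R t4) n + e t8 * char_prime_sum (chr8 R t8) n +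
    e tm8 * char_prime_sum (chr8 R tm8) n.
  have -> : ln 2%:R / 2%:R = \sum_(0 <= p < n.+1 | prime p) (p == 2)%:R * (ln p%:R / p%:R) :> R.
    rewrite big_mkcond (bigD1_seq 2%N) ?iota_uniq ?mem_index_iota //=; last by lia.
    by rewrite mul1r big1 ?addr0 // => p /negbTE ->; rewrite mul0r if_same.
  rewrite /prime_sum_mod8 /prime_sum /char_prime_sum big_mkcondr.
  rewrite !mulr_sumr -sumrB -!big_split /=; apply: eq_bigr => p pp.
  have F : 4 * (if (p %% 8 == a)%N then 1 else 0) =
     1 - (p == 2)%:R + e t4 * chr8 R t4 p + e t8 * chr8 R t8 p + e tm8 * chr8 R tm8 p.
    have [p2 | op] := even_prime pp.
      by rewrite p2 /e /chr8; case: a35 => -> /=; lra.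
    have -> : (p == 2)%N = false by apply/eqP => p2; rewrite p2 in op.
    have : [|| p %% 8 == 1, p %% 8 == 3, p %% 8 == 5 | p %% 8 == 7]%N by lia.
    by rewrite /e /chr8 => /or4P[] /eqP ->; case: a35 => -> /=; lra.
  transitivity (4 * (if (p %% 8 == a)%N then 1 else 0 : R) * (ln p%:R / p%:R)).
    by case: (p %% 8 == a)%N; ring.
  rewrite F; ring.
have /andP[M1 M2] := @mertens R n (leq_trans (isT : 0 < 8)%N n8).
have l2 : (0 <= ln 2%:R / 2%:R :> R) && (ln 2%:R / 2%:R <= 1 :> R).
  have := @ln_sublinear R 2%:R; have := ln_nat_ge0 R 2; rewrite ltr0n => l0 /(_ isT) l2.
  by apply/andP; split; lra.
have B t : t \in [:: t4; t8; tm8] -> is_char (chr8 R t) ->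
    `|e t * char_prime_sum (chr8 R t) n| <= 80.
  move=> tt ct; rewrite normrM -[80]mul1r.
  by apply: ler_pM => //; [exact: e1 | exact: char_prime_sum_le].
have := B t4 isT (t4_is_char R); have := B t8 isT (t8_is_char R).
have := B tm8 isT (tm8_is_char R); rewrite E !ler_norml.
move=> /andP[? ?] /andP[? ?] /andP[? ?]; case/andP: l2 => ? ?.
apply/andP; split; lra.
Qed.

Lemma prime_sum_mod8_gap (R : realType) a : (a = 3 \/ a = 5)%N ->
  exists2 L : nat, (8 <= L)%N & forall n, (8 <= n)%N ->
    1 <= \sum_(n.+1 <= p < (L * n).+1 | prime p && (p %% 8 == a)%N) ln p%:R / p%:R :> R.
Proof.
move=> a35.
(* 504 = 2 * 250 + 4: an error of 250 at each end, and 4 to leave a sum of at least 1 after division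
   by 4. *)
have [L L8 lnL] : exists2 L : nat, (8 <= L)%N & 504 <= ln L%:R :> R.
  have := truncnS_gt (expR 504 : R); move: (Num.truncn _) => t ht.
  exists (t + 8)%N; first exact: leq_addl.
  rewrite -[X in X <= _](@expRK R) ler_ln ?posrE ?expR_gt0 ?ltr0n ?addn_gt0 ?orbT //.
  by apply: ltW; apply: lt_le_trans ht _; rewrite ler_nat; lia.
exists L => // n n8.
have Ln : (8 <= L * n)%N by nia.
have H1 := @mertens_mod8 R a _ a35 n8; have H2 := @mertens_mod8 R a _ a35 Ln.
have E : prime_sum_mod8 R a (L * n)%N = prime_sum_mod8 R a n +
   \sum_(n.+1 <= p < (L * n).+1 | prime p && (p %% 8 == a)%N) ln p%:R / p%:R.
  by rewrite /prime_sum_mod8 (@big_cat_nat _ _ _ n.+1) //=; nia.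
move: H1 H2; rewrite E !ler_norml natrM lnM ?posrE ?ltr0n //; try lia.
by move=> /andP[? ?] /andP[? ?]; lra.
Qed.

(** * Counts and reciprocal sums of primes in the classes 3 and 5 *)

Definition primes_mod8 (a n : nat) : seq nat :=
  [seq p <- index_iota 0 n.+1 | prime p && (p %% 8 == a)%N].

Lemma mem_primes_mod8 a n p :
  (p \in primes_mod8 a n) = [&& prime p, (p %% 8 == a)%N & (p <= n)%N].
Proof. by rewrite mem_filter mem_index_iota /= ltnS andbA. Qed.

(** With n = floor(m / L), each prime in (n, Ln] contributes at most ln m / n to a sum that is at
    least 1. So there are at least n / ln m of them, and n >= m / (2L). *)
Lemma size_primes_mod8_ge (R : realType) a : (a = 3 \/ a = 5)%N ->
  exists2 c : R, 0 < c & exists m0 : nat, forall m, (m0 <= m)%N ->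
    c * m%:R / ln m%:R <= (size (primes_mod8 a m))%:R.
Proof.
move=> a35; have [L L8 HL] := prime_sum_mod8_gap R a35.
have L0 : 0 < L%:R :> R by rewrite ltr0n; lia.
exists (2 * L%:R)^-1; first by rewrite invr_gt0 mulr_gt0.
exists (8 * L)%N => m mL.
have [n Lnm ceil] : exists2 n, (L * n <= m)%N & (m < L * n.+1)%N.
  by exists (m %/ L)%N; rewrite mulnC ?leq_divM // ltn_ceil //; lia.
have n8 : (8 <= n)%N by nia.
have nm : (n <= m)%N by nia.
have m1 : (1 < m)%N by nia.
have lm : 0 < ln m%:R :> R by rewrite ln_gt0 // ltr1n.
have n0 : 0 < n%:R :> R by rewrite ltr0n; lia.
have H : 1 <= (size (primes_mod8 a m))%:R * (ln m%:R / n%:R) :> R.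
  apply: le_trans (HL n n8) _.
  apply: (@le_trans _ _ (\sum_(n.+1 <= p < (L * n).+1 | prime p && (p %% 8 == a)%N) ln m%:R / n%:R)).
    rewrite [X in X <= _]big_nat_cond [X in _ <= X]big_nat_cond.
    apply: ler_sum => p /andP[/andP[np pL] _].
    apply: ler_pM; rewrite ?ln_nat_ge0 ?invr_ge0 ?ler0n //.
      by apply: ler_ln_nat; apply/andP; split; lia.
    by rewrite lef_pV2 ?posrE ?ltr0n ?ler_nat; lia.
  have c0 : 0 <= ln m%:R / n%:R :> R by rewrite divr_ge0 ?ltW.
  rewrite mulr_natl /primes_mod8 size_filter -[X in _ <= X]iter_addr_0 -big_const_seq.
  rewrite [X in _ <= X](@big_cat_nat _ _ _ n.+1) //=.
  rewrite [X in _ <= _ + X](@big_cat_nat _ _ _ (L * n).+1) //=; last by rewrite ltnS leq_pmull //; lia.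
  by rewrite addrCA lerDl addr_ge0 // sumr_ge0.
have mn : m%:R <= 2 * L%:R * n%:R :> R.
  by rewrite -!natrM ler_nat; nia.
rewrite ler_pdivrMr // mulrC ler_pdivrMr ?mulr_gt0 //.
move: H; rewrite mulrA ler_pdivlMr // mul1r => H.
apply: le_trans mn _; nra.
Qed.

Lemma ln_succ_le_harmonic (R : realType) k : ln k.+1%:R <= \sum_(1 <= i < k.+1) i%:R^-1 :> R.
Proof.
elim: k => [|k IH]; first by rewrite ln1 big_geq.
rewrite big_nat_recr //=; have := ln_succ_sub_le R (ltn0Sn k).
by rewrite lerBlDl => /le_trans; apply; rewrite lerD2r.
Qed.

(** On the block (L^i, L^(i+1)] the sum of ln p / p is at least 1 and ln p <= 2 i ln L, so the
    reciprocals sum to at least 1/(2 i ln L). The harmonic sum over the blocks is the source of log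
    log. *)
Lemma sum_inv_primes_mod8_ge (R : realType) a : (a = 3 \/ a = 5)%N ->
  exists2 L : nat, (8 <= L)%N & forall k,
    ln k.+1%:R / (2 * ln L%:R) <= \sum_(p <- primes_mod8 a (L ^ k.+1)) p%:R^-1 :> R.
Proof.
move=> a35; have [L L8 HL] := prime_sum_mod8_gap R a35; exists L => // k.
have lL : 0 < ln L%:R :> R by rewrite ln_gt0 // ltr1n; lia.
suff H : (\sum_(1 <= i < k.+1) i%:R^-1) / (2 * ln L%:R) <=
    \sum_(p <- primes_mod8 a (L ^ k.+1)) p%:R^-1 :> R.
  apply: le_trans H; rewrite ler_pM2r ?invr_gt0 ?mulr_gt0 //.
  exact: ln_succ_le_harmonic.
rewrite /primes_mod8 big_filter.
elim: k => [|k IH]; first by rewrite [X in X / _]big_geq // mul0r sumr_ge0 // => p _; rewrite invr_ge0 ler0n.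
rewrite [X in X / _]big_nat_recr //= mulrDl.
have Lk : (8 <= L ^ k.+1)%N by rewrite (leq_trans L8) // -[X in (X <= _)%N]expn1 leq_exp2l //; lia.
have LL : (L ^ k.+1 <= L ^ k.+2)%N by rewrite leq_exp2l //; lia.
rewrite (@big_cat_nat _ _ _ (L ^ k.+1).+1 0 (L ^ k.+2).+1) //.
apply: lerD => //; have := HL _ Lk; rewrite -expnS => H.
have lk : 0 < k.+1%:R * (2 * ln L%:R) :> R by rewrite !mulr_gt0 ?ltr0n.
rewrite -invfM -[X in X <= _]mul1r ler_pdivrMr //; apply: le_trans H _.
rewrite mulr_suml [X in X <= _]big_nat_cond [X in _ <= X]big_nat_cond.
apply: ler_sum => p /andP[/andP[_ pL] _].
rewrite mulrC; apply: ler_wpM2l; first by rewrite invr_ge0 ler0n.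
have [-> | p0] := posnP p; first by rewrite ln0 // ltW.
apply: (@le_trans _ _ (ln (L ^ k.+2)%N%:R)); first by apply: ler_ln_nat; rewrite p0 -ltnS.
rewrite natrX lnXn ?ltr0n //; last by lia.
rewrite -[X in X <= _]mulr_natl mulrA; apply: ler_wpM2r; first exact: ltW.
by rewrite -natrM ler_nat; lia.
Qed.

(** * Counting odd coefficients *)

(** Distinct pairs give distinct n: the residues 3 and 5 modulo 8 tell the two factors of pq
    apart. *)
Lemma count_ntri_odd_ge x s :
  (\sum_(q <- primes_mod8 5 s) size (primes_mod8 3 ((8 * x + 7) %/ q)) <=
   count (fun n => odd (ntri n)) (iota 0 x.+1))%N.
Proof.
pose ps := [seq (q, p) | q <- primes_mod8 5 s, p <- primes_mod8 3 ((8 * x + 7) %/ q)].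
have memP q p : (q, p) \in ps ->
    [/\ prime q, (q %% 8 = 5)%N, prime p, (p %% 8 = 3)%N & (p * q <= 8 * x + 7)%N].
  move=> /allpairsPdep[q' [p' [+ + [-> ->]]]]; rewrite !mem_primes_mod8.
  move=> /and3P[pq /eqP q8 _] /and3P[pp /eqP p8 pX]; split=> //.
  by rewrite -leq_divRL // prime_gt0.
have Npq q p : (q, p) \in ps -> (p * q = 8 * ((p * q) %/ 8) + 7)%N.
  move=> /memP[_ q8 _ p8 _]; rewrite {1}(divn_eq (p * q) 8) mulnC; congr (_ + _)%N.
  by rewrite -modnMm q8 p8.
have -> : (\sum_(q <- primes_mod8 5 s) size (primes_mod8 3 ((8 * x + 7) %/ q)))%N =
    size [seq ((u.2 * u.1) %/ 8)%N | u <- ps].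
  by rewrite size_map size_allpairs_dep sumnE big_map.
rewrite -size_filter; apply: uniq_leq_size.
  rewrite map_inj_in_uniq.
    apply: allpairs_uniq_dep => [|q _|[q p] [q' p'] _ _ /= [-> ->] //].
      exact: filter_uniq (iota_uniq _ _).
    exact: filter_uniq (iota_uniq _ _).
  move=> [q p] [q' p'] h h' /= E.
  have EN : (p * q = p' * q')%N by rewrite (Npq _ _ h) (Npq _ _ h') E.
  have [pq q8 pp p8 _] := memP _ _ h; have [pq' q8' pp' p8' _] := memP _ _ h'.
  have Ep : p = p'.
    have : (p %| p' * q')%N by rewrite -EN dvdn_mulr.
    rewrite Euclid_dvdM // !dvdn_prime2 // => /orP[/eqP // | /eqP Epq].
    by move: p8; rewrite Epq q8'.
  congr (_, _) => //; apply/eqP; rewrite -(eqn_pmul2l (prime_gt0 pp)) EN Ep.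
  by rewrite -Ep.
move=> n /mapP[[q p] h ->]; have [pq q8 pp p8 le] := memP _ _ h.
rewrite mem_filter; apply/andP; split; first exact: ntri_odd_pq pp pq p8 q8 (Npq _ _ h).
by rewrite mem_iota /= ltnS; have := Npq _ _ h; lia.
Qed.

(** By [ntri_odd] every n counted on the left is m + 8 tri k with c(m) odd. Here 4k(k+1) <= x < K^2,
    so fewer than K values of k occur. *)
Lemma count_ntri_odd_le x K : (x < K * K)%N ->
  (count (fun n => odd (ntri n)) (iota 0 x.+1) <=
   K * count (fun n => oddz (c_coef n)) (iota 0 x.+1))%N.
Proof.
move=> xK; rewrite -!size_filter; set s := [seq n <- _ | oddz _].
have -> : (K * size s = size [seq (m + 8 * tri k)%N | k <- iota 0 K, m <- s])%N.
  by rewrite size_allpairs size_iota.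
apply: uniq_leq_size; first exact: filter_uniq (iota_uniq _ _).
move=> n; rewrite mem_filter mem_iota => /andP[/ntri_odd[k kn odd_c] nx].
apply/allpairsP; exists (k, n - 8 * tri k)%N; split.
- rewrite mem_iota /= add0n; have := double_tri k; nia.
- rewrite mem_filter; apply/andP; split; first exact: odd_c.
  by rewrite mem_iota /=; lia.
- by rewrite /= subnK.
Qed.

Lemma count_c_odd_le_f_c1 (R : realType) (x : R) n : n%:R <= x ->
  (count (fun n => oddz (c_coef n)) (iota 0 n.+1) <= f_c1 x)%N.
Proof.
move=> nx; rewrite /f_c1 -size_filter; set r := [seq _ <- _ | _].
have ur : uniq r by exact: filter_uniq (iota_uniq _ _).
apply: leq_trans (_ : _ <= #|` [fset m in r]%fset|)%N _.
  by rewrite card_fseq undup_id.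
apply: fsubset_leq_card; apply/fsubsetP => m; rewrite inE mem_filter mem_iota => /andP[om mn].
rewrite in_fset_set ?inE; last exact: finite_c_odd_set.
by split=> //; apply: le_trans nx; rewrite ler_nat; lia.
Qed.

Lemma count_c_odd_le_f_j1 (R : realType) (x : R) n : (8 * n)%N%:R <= x ->
  (count (fun n => oddz (c_coef n)) (iota 0 n.+1) <= f_j1 x)%N.
Proof.
move=> nx; rewrite /f_j1 -size_filter; set r := [seq _ <- _ | _].
have ur : uniq r by exact: filter_uniq (iota_uniq _ _).
pose h (m : nat) : int := (8 * m)%N%:Z - 1.
have uh : uniq (map h r) by rewrite map_inj_uniq // /h => a b; lia.
rewrite -(size_map h); apply: leq_trans (_ : _ <= #|` [fset m in map h r]%fset|)%N _.
  by rewrite card_fseq undup_id.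
apply: fsubset_leq_card; apply/fsubsetP => z; rewrite inE => /mapP[m].
rewrite mem_filter mem_iota => /andP[om mn] ->.
rewrite in_fset_set ?inE; last exact: finite_j_odd_set.
split; rewrite /h; first by lia.
  apply: le_trans nx; rewrite rmorphB /= lerBlDr.
  apply: (@le_trans _ _ (8 * n)%N%:R); last by rewrite lerDl.
  by rewrite -[X in X <= _]/((8 * m)%N%:R) ler_nat; lia.
by rewrite /j_coef subrK oddz_qj.
Qed.

(** Take q up to a power s of L with s^2 <= X = 8x + 7. Then X/q >= s is large enough for the bound
    on the number of p, of order X / (q ln X), and summing 1/q yields log log X. *)
Lemma count_ntri_odd_asymp (R : realType) :
  exists2 c : R, 0 < c & exists x0 : nat, forall x, (x0 <= x)%N ->
    c * ((8 * x + 7)%N%:R * ln (ln (8 * x + 7)%N%:R) / ln (8 * x + 7)%N%:R) <=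
    (count (fun n => odd (ntri n)) (iota 0 x.+1))%:R.
Proof.
have [c3 c30 [m0 H3]] := @size_primes_mod8_ge R 3 (or_introl erefl).
have [L L8 H5] := @sum_inv_primes_mod8_ge R 5 (or_intror erefl).
have lL : 0 < ln L%:R :> R by rewrite ln_gt0 // ltr1n; lia.
(* 8 = 2 * 2 * 2: the integer part of X/q, the constant in the reciprocal sum, and ln ln X <= 2
   ln(k+1). *)
exists (c3 / (8 * ln L%:R)); first by rewrite divr_gt0 // mulr_gt0.
have [T HT] : exists T : nat, expR ((4 * ln L%:R) ^+ 2) <= T%:R :> R.
  exists (Num.truncn (expR ((4 * ln L%:R) ^+ 2) : R)).+1; exact: ltW (truncnS_gt _).
(* T ensures ln X >= (4 ln L)^2, the second term s >= m0, and the third that X reaches L^2, so the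
   power s exists. *)
exists (T + m0 * L * (m0 * L) + L * L)%N => x x0.
set X := (8 * x + 7)%N.
have XT : (T <= X)%N by rewrite /X; lia.
have Xm : (m0 * L * (m0 * L) <= X)%N by rewrite /X; move: (m0 * L * _)%N x0 => u; lia.
have XL : (L * L <= X)%N by rewrite /X; move: (L * L)%N (m0 * L * _)%N x0 => u v; lia.
have X1 : (1 < X)%N by rewrite /X; lia.
have lX : 0 < ln X%:R :> R by rewrite ln_gt0 // ltr1n.
have lXL : (4 * ln L%:R) ^+ 2 <= ln X%:R :> R.
  rewrite -[X in X <= _](@expRK R) ler_ln ?posrE ?expR_gt0 ?ltr0n //; last by lia.
  by apply: le_trans HT _; rewrite ler_nat.
have [k Lk1 Lk2] : exists2 k, (L ^ k.+1 * L ^ k.+1 <= X)%N & (X < L ^ k.+2 * L ^ k.+2)%N.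
  have LL1 : (1 < L ^ 2)%N by rewrite (@ltn_exp2r 1 L 2) //; lia.
  have /andP[b1 b2] := @trunc_log_bounds (L ^ 2) X LL1 (ltnW X1).
  have LX : (L ^ 2 <= X)%N by rewrite -mulnn.
  have : (0 < trunc_log (L ^ 2) X)%N by rewrite trunc_log_gt0 LL1; lia.
  move: (trunc_log _ _) b1 b2 => [//|k] b1 b2 _; exists k.
    by rewrite -expnMn mulnn.
  by rewrite -expnMn mulnn.
set s := (L ^ k.+1)%N in Lk1.
have s8 : (8 <= s)%N by rewrite (leq_trans L8) // -[X in (X <= _)%N]expn1 leq_exp2l //; lia.
have sm : (m0 <= s)%N.
  rewrite leqNgt; apply/negP => ltsm.
  have h : (s * L <= m0 * L)%N by rewrite leq_mul2r ltnW ?orbT.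
  have := leq_trans (leq_mul h h) Xm; rewrite leqNgt.
  by rewrite (leq_trans Lk2) // !(expnS L k.+1) -/s (mulnC L).
have key : c3 * X%:R / (2 * ln X%:R) * (ln k.+1%:R / (2 * ln L%:R)) <=
    (\sum_(q <- primes_mod8 5 s) size (primes_mod8 3 (X %/ q)))%N%:R :> R.
  have c0 : 0 <= c3 * X%:R / (2 * ln X%:R) :> R.
    by rewrite divr_ge0 ?mulr_ge0 ?ler0n // ltW.
  apply: le_trans (ler_wpM2l c0 (H5 k)) _; rewrite -/s mulr_sumr natr_sum.
  rewrite big_seq [X in _ <= X]big_seq; apply: ler_sum => q; rewrite mem_primes_mod8.
  move=> /and3P[pq _ qs]; have q0 := prime_gt0 pq.
  have q0' : 0 < q%:R :> R by rewrite ltr0n.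
  have sq : (s <= X %/ q)%N by rewrite leq_divRL // (leq_trans _ Lk1) // leq_mul2l qs orbT.
  have Xq : (X <= 2 * (X %/ q) * q)%N.
    have := ltn_ceil X q0; move: (X %/ q)%N sq => m sq; nia.
  have mX : (X %/ q <= X)%N by exact: leq_div.
  apply: le_trans (H3 _ (leq_trans sm sq)).
  move: (X %/ q)%N sq Xq mX => m sq Xq mX.
  have lm : 0 < ln m%:R :> R by rewrite ln_gt0 // ltr1n; lia.
  have lmX : ln m%:R <= ln X%:R :> R by apply: ler_ln_nat; lia.
  have Xq' : X%:R / (2 * q%:R) <= m%:R :> R.
    rewrite ler_pdivrMr ?mulr_gt0 // -!natrM ler_nat; lia.
  have -> : c3 * X%:R / (2 * ln X%:R) / q%:R = c3 * (X%:R / (2 * q%:R)) / ln X%:R.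
    by field; rewrite !gt_eqF.
  apply: ler_pM.
  - by rewrite mulr_ge0 ?divr_ge0 ?ler0n ?mulr_ge0 ?ltW.
  - by rewrite invr_ge0 ltW.
  - by rewrite ler_pM2l.
  - by rewrite lef_pV2.
have lnk : ln (ln X%:R) <= 2 * ln k.+1%:R :> R.
  have k0 : 0 < k.+1%:R :> R by rewrite ltr0n.
  rewrite (_ : 2 * _ = ln (k.+1%:R ^+ 2)); last by rewrite lnXn // mulr_natl.
  rewrite ler_ln ?posrE ?exprn_gt0 //.
  have h : ln X%:R <= 4 * ln L%:R * k.+1%:R :> R.
    apply: (@le_trans _ _ (ln (L ^ k.+2 * L ^ k.+2)%N%:R)).
      by apply: ler_ln_nat; rewrite (ltnW X1) ltnW.
    rewrite -expnD natrX lnXn ?ltr0n; last by lia.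
    rewrite -[X in X <= _]mulr_natr -mulrA (mulrCA 4); apply: ler_wpM2l; first exact: ltW.
    by rewrite -natrM ler_nat; lia.
  have l4 : 0 < 4 * ln L%:R :> R by rewrite mulr_gt0.
  (* From ln X <= 4 ln L (k+1), squaring and absorbing (4 ln L)^2 into one factor ln X leaves ln X
     <= (k+1)^2. *)
  rewrite -(ler_pM2l lX); apply: (@le_trans _ _ ((4 * ln L%:R * k.+1%:R) ^+ 2)).
    by rewrite -expr2 lerXn2r // nnegrE ltW // mulr_gt0.
  by rewrite exprMn; apply: ler_wpM2r => //; rewrite exprn_ge0 ?ltW.
have := count_ntri_odd_ge x s; rewrite -/X -(ler_nat R) => H.
apply: le_trans H; apply: le_trans key.
have -> : c3 * X%:R / (2 * ln X%:R) * (ln k.+1%:R / (2 * ln L%:R)) =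
    c3 / (8 * ln L%:R) * (X%:R * (2 * ln k.+1%:R) / ln X%:R).
  by field; rewrite !gt_eqF.
rewrite ler_pM2l; last by rewrite divr_gt0 // mulr_gt0.
by rewrite ler_pM2r ?invr_gt0 // ler_wpM2l ?ler0n.
Qed.

Lemma count_c_odd_asymp (R : realType) :
  exists C y0 : R, [/\ 0 < C, 1 <= y0 & forall y, y0 <= y ->
    C * (Num.sqrt y * ln (ln y) / ln y) <=
    (count (fun n => oddz (c_coef n)) (iota 0 (Num.truncn y).+1))%:R].
Proof.
have [c c0 [x0 H]] := count_ntri_odd_asymp R.
have e0 : 0 < expR 2 :> R by exact: expR_gt0.
(* One factor 2 comes from floor(sqrt y) + 1 <= 2 sqrt y, the other from ln X <= 2 ln y for X = 8
   floor(y) + 7. The latter follows from X <= y^2, valid for y >= 15; expR 2 makes ln ln y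
   nonnegative. *)
exists (c / 4), (x0%:R + 15 + expR 2); split; first by rewrite divr_gt0.
  by have := ler0n R x0; lra.
move=> y yx; have x00 := ler0n R x0.
have y15 : 15 <= y by lra.
have yp : 0 < y by lra.
have xy : (Num.truncn y)%:R <= y by rewrite truncn_le; lra.
have yx1 := truncnS_gt y.
have xx0 : (x0 <= Num.truncn y)%N by rewrite truncn_ge_nat; lra.
move: (Num.truncn y) xy yx1 xx0 => x xy yx1 xx0.
have sy : 1 <= Num.sqrt y by rewrite -[1]sqrtr1 ler_sqrt; lra.
have sK := truncnS_gt (Num.sqrt y).
have sk : (Num.truncn (Num.sqrt y))%:R <= Num.sqrt y by rewrite truncn_le; lra.
move: (Num.truncn _) sK sk => k sK sk.
have ssy : Num.sqrt y * Num.sqrt y = y by rewrite -expr2 sqr_sqrtr // ltW.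
have xK : (x < k.+1 * k.+1)%N.
  rewrite -(ltr_nat R) natrM; apply: le_lt_trans xy _; rewrite -ssy.
  by apply: ltr_pM => //; lra.
have := leq_trans (leqnn _) (count_ntri_odd_le xK).
rewrite -(ler_nat R) natrM => H2.
have {H} H1 := le_trans (H x xx0) H2.
move: (count _ _) H1 => N H1.
have X1 : y <= (8 * x + 7)%N%:R by rewrite natrD natrM; move: yx1; rewrite -natr1; lra.
have X2 : (8 * x + 7)%N%:R <= y * y.
  by rewrite natrD natrM; have : 0 <= x%:R :> R by []; nra.
move: ((8 * x + 7)%N%:R) X1 X2 H1 => X X1 X2 H1.
have ly : 2 <= ln y.
  by rewrite -[X in X <= _](@expRK R) ler_ln ?posrE ?expR_gt0; lra.
have lX : ln y <= ln X by rewrite ler_ln ?posrE; lra.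
have lX2 : ln X <= 2 * ln y.
  rewrite (_ : 2 * ln y = ln (y * y)); last by rewrite lnM ?posrE //; lra.
  by rewrite ler_ln ?posrE ?mulr_gt0 //; lra.
have lly : 0 <= ln (ln y) by rewrite ln_ge0; lra.
have llX : ln (ln y) <= ln (ln X) by rewrite ler_ln ?posrE; lra.
have h : c * (y * ln (ln y) / (2 * ln y)) <= 2 * Num.sqrt y * N%:R.
  apply: le_trans (le_trans _ H1) _.
    rewrite ler_pM2l //; apply: ler_pM.
    - by rewrite mulr_ge0 // ltW.
    - by rewrite invr_ge0; lra.
    - by apply: ler_pM => //; exact: ltW.
    - by rewrite lef_pV2 ?posrE; lra.
  by apply: ler_wpM2r; rewrite ?ler0n // -natr1; lra.
rewrite -(@ler_pM2l _ (2 * Num.sqrt y)); last by lra.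
apply: le_trans h; rewrite le_eqVlt; apply/orP; left; apply/eqP.
transitivity (c * (Num.sqrt y * Num.sqrt y * ln (ln y) / (2 * ln y))); last by rewrite ssy.
by field; rewrite gt_eqF //; lra.
Qed.

Theorem theorem2p2 (R : realType) :
  exists C x0 : R, 0 < C /\
    forall x : R, x0 <= x ->
      C * (Num.sqrt x * ln (ln x) / ln x) <= (f_j1 x)%:R /\
      C * (Num.sqrt x * ln (ln x) / ln x) <= (f_c1 x)%:R.
Proof.
have [C [y0 [C0 y1 H]]] := count_c_odd_asymp R.
(* The odd j(8m - 1) are governed by y = x/8, with sqrt x <= 3 sqrt y and ln ln x <= 2 ln ln y,
   hence 6. The bound 64 gives x <= y^2, so ln x <= 2 ln y; with ln x >= 4 this yields ln x <= (ln
   y)^2. *)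
exists (C / 6), (8 * y0 + expR 4 + 64); split; first by rewrite divr_gt0.
have e0 : 0 < expR 4 :> R by exact: expR_gt0.
move=> x xx.
have x64 : 64 <= x by lra.
have lx : 4 <= ln x.
  by rewrite -[X in X <= _](@expRK R) ler_ln ?posrE ?expR_gt0; lra.
have llx : 0 <= ln (ln x) by rewrite ln_ge0; lra.
have G0 : 0 <= Num.sqrt x * ln (ln x) / ln x.
  by rewrite divr_ge0 ?mulr_ge0 ?sqrtr_ge0; lra.
split; last first.
  apply: (@le_trans _ _ (C * (Num.sqrt x * ln (ln x) / ln x))).
    by apply: ler_wpM2r => //; lra.
  apply: le_trans (H x _) _; first by lra.
  by rewrite ler_nat; apply: count_c_odd_le_f_c1; rewrite truncn_le; lra.
pose y := x / 8.
have yx : x = 8 * y by rewrite /y; lra.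
apply: (@le_trans _ _ (C * (Num.sqrt y * ln (ln y) / ln y))); last first.
  apply: le_trans (H y _) _; first by rewrite /y; lra.
  rewrite ler_nat; apply: count_c_odd_le_f_j1; rewrite yx natrM ler_pM2l //.
  by rewrite truncn_le /y; lra.
have y8 : 8 <= y by rewrite /y; lra.
have ly : ln x <= 2 * ln y.
  rewrite (_ : 2 * ln y = ln (y * y)); last by rewrite lnM ?posrE //; lra.
  by rewrite ler_ln ?posrE; nra.
have ly2 : ln y <= ln x by rewrite ler_ln ?posrE; lra.
have lly : ln (ln x) <= 2 * ln (ln y).
  rewrite (_ : 2 * ln (ln y) = ln (ln y * ln y)); last by rewrite lnM ?posrE //; lra.
  by rewrite ler_ln ?posrE; nra.
have sy : Num.sqrt x <= 3 * Num.sqrt y.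
  rewrite -(@ler_pXn2r _ 2) // ?nnegrE ?mulr_ge0 ?sqrtr_ge0 //.
  by rewrite exprMn !sqr_sqrtr; lra.
have lly0 : 0 <= ln (ln y) by lra.
have -> : C / 6 * (Num.sqrt x * ln (ln x) / ln x) = C * ((Num.sqrt x / 3 * (ln (ln x) / 2)) / ln x).
  by field; rewrite gt_eqF //; lra.
rewrite ler_pM2l //; apply: ler_pM.
- by rewrite mulr_ge0 // divr_ge0 // sqrtr_ge0.
- by rewrite invr_ge0; lra.
- by apply: ler_pM; rewrite ?divr_ge0 ?sqrtr_ge0 //; lra.
- by rewrite lef_pV2 ?posrE; lra.
Qed.
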